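(* The Cayley set $\mathfrak{C}$ is a constructible set, and more precisely it is the algebraic subvariety of $\mathfrak{O}$ defined by the equation $$-\sigma_{1,2}^{2}+4\,\sigma_{0,3}\,\sigma_{2,1}=0 .$$ Therefore the dimension of $\mathfrak{C}$ is $9$.
   Context: A conic in $\mathbb{CP}^2$ is identified with its symmetric $3\times 3$ complex matrix up to a non-zero scalar, so conics form $\mathbb{CP}^5$. $\mathfrak{U}\subset\mathbb{CP}^5$ is the open set of non-degenerate conics ($\det\neq 0$). $\mathfrak{O}\subset \mathfrak{U}\times\mathfrak{U}$ is the set of pairs $(C,D)$ of non-degenerate conics that intersect transversely, i.e. in four distinct points. For matrices $C,D$ write $P(t)=\det(tC+D)=\sigma_{3,0}t^3+\sigma_{2,1}t^2+\sigma_{1,2}t+\sigma_{0,3}$, so that $\sigma_{3,0}=\det C$, $\sigma_{0,3}=\det D$, and $\sigma_{2,1},\sigma_{1,2}$ are bihomogeneous polynomials in the entries of $C$ and $D$. Consider the Taylor expansion at $t=0$, $\sqrt{\det(tC+D)}=A_0+A_1t+A_2t^2+\cdots$ (for a branch of the square root near $P(0)=\det D\neq0$; the vanishing of $A_2$ does not depend on the branch or on the matrix representatives). The Cayley set (for triangles) is $\mathfrak{C}=\{(C,D)\in\mathfrak{O} : A_2=0\}$. A constructible set is a finite union of locally closed subsets, here in the Zariski topology of $\mathbb{CP}^5\times\mathbb{CP}^5$. *)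

(* Defs.v *)
From HB Require Import structures.
From mathcomp Require Import all_boot all_order all_algebra.
From mathcomp Require Import generic_quotient.
From mathcomp Require Import boolp classical_sets functions cardinality.
From mathcomp Require Import topology normedtype sequences.
(* the notations of mpoly clash with those of MathComp-Analysis *)
From mathcomp Require Import -(notations) mpoly.

Set Implicit Arguments.
Unset Strict Implicit.
Unset Printing Implicit Defensive.

Import Order.TTheory GRing.Theory Num.Theory.
Import numFieldNormedType.Exports.

Local Open Scope classical_set_scope.
Local Open Scope card_scope.
Local Open Scope ring_scope.
Local Open Scope quotient_scope.

Section Topology.
Context {T : topologicalType}.
Implicit Types A F G : set T.

Definition locally_closed A :=
  exists U F, [/\ open U, closed F & A = U `&` F].

Definition constructible A :=
  exists (n : nat) (B : 'I_n -> set T),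
    (forall i, locally_closed (B i)) /\ A = \bigcup_i B i.

Definition closed_in A (Z : set T) := exists2 F, closed F & Z = A `&` F.

Definition irreducible (Z : set T) :=
  Z !=set0 /\
  forall F G, closed F -> closed G -> Z `<=` F `|` G -> Z `<=` F \/ Z `<=` G.

Definition irreducible_chain A (d : nat) (Z : nat -> set T) :=
  (forall i, (i <= d)%N -> closed_in A (Z i) /\ irreducible (Z i)) /\
  (forall i, (i < d)%N -> Z i `<` Z i.+1).

(* [A], with the induced topology, has Krull dimension [d]. *)
Definition has_dimension A (d : nat) :=
  (exists Z, irreducible_chain A d Z) /\
  (forall e Z, irreducible_chain A e Z -> (e <= d)%N).

End Topology.

Section ProjectiveSpace.
Variables (K : fieldType) (n : nat).

Definition nzvec := {v : 'rV[K]_n.+1 | v != 0}.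

Definition proportional (u v : nzvec) : bool :=
  `[< exists2 c : K, c != 0 & val v = c *: val u >].

Lemma proportional_equiv : equiv_class_of proportional.
Proof.
have sym u v : proportional u v -> proportional v u.
  move=> /asboolP[c c0 vE]; apply/asboolP; exists c^-1; rewrite ?invr_eq0 //.
  by rewrite vE scalerA mulVf // scale1r.
split=> [u|u v|v u w].
- by apply/asboolP; exists 1; rewrite ?oner_eq0 // scale1r.
- by apply/idP/idP; exact: sym.
- move=> /asboolP[c c0 vE] /asboolP[d d0 wE]; apply/asboolP; exists (d * c).
    by rewrite mulf_neq0.
  by rewrite wE vE scalerA.
Qed.

Canonical proportional_equivRel := EquivRelPack proportional_equiv.

Definition pspace := {eq_quot proportional}.

HB.instance Definition _ := Choice.on pspace.

(* homogeneous coordinates of a chosen representative *)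
Definition hcoord (x : pspace) : 'rV[K]_n.+1 := val (repr x).

End ProjectiveSpace.

Section Zariski.
Variables (K : fieldType) (n m : nat).

(* P^n x P^m, an alias of the product that carries the Zariski topology (which
   is not the product topology) *)
Definition bipspace := (pspace K n * pspace K m)%type.

HB.instance Definition _ := Choice.on bipspace.

Definition bihomogeneous (f : mpoly (n.+1 + m.+1) K) :=
  exists a b : nat, forall e, e \in msupp f ->
    (\sum_(i < n.+1) e (lshift m.+1 i))%N = a /\
    (\sum_(j < m.+1) e (rshift n.+1 j))%N = b.

Definition hcoords (p : bipspace) : 'I_(n.+1 + m.+1) -> K :=
  row_mx (hcoord p.1) (hcoord p.2) 0.

(* Only used for bihomogeneous polynomials, whose vanishing does not depend on
   the representatives chosen by [hcoord]. *)
Definition zero_locus (F : set (mpoly (n.+1 + m.+1) K)) : set bipspace :=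
  [set p | forall f, F f -> meval (hcoords p) f = 0].

Definition zariski_closed (Z : set bipspace) :=
  exists F, (forall f, F f -> bihomogeneous f) /\ Z = zero_locus F.

Definition zariski_open (U : set bipspace) := zariski_closed (~` U).

Lemma bihomogeneous1 : bihomogeneous 1.
Proof.
exists 0%N, 0%N => e; rewrite msupp1 inE => /eqP ->.
by split; apply: big1 => i _; rewrite mnm0E.
Qed.

Lemma bihomogeneousM f g :
  bihomogeneous f -> bihomogeneous g -> bihomogeneous (f * g).
Proof.
move=> [a [b fab]] [c [d gcd]]; exists (a + c)%N, (b + d)%N => e.
move=> /msuppM_le /allpairsP[[e1 e2] /= [/fab[<- <-] /gcd[<- <-] ->]].
by rewrite -!big_split; split; apply: eq_bigr => i _; rewrite mnmDE.
Qed.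

Lemma zariski_openT : zariski_open setT.
Proof.
exists [set 1]; split=> [f -> | ]; first exact: bihomogeneous1.
rewrite setCT; apply/seteqP; split=> // p /(_ 1 erefl) /eqP.
by rewrite meval1 oner_eq0.
Qed.

Lemma zariski_openI : setI_closed zariski_open.
Proof.
move=> U V [F [Fh UF]] [G [Gh VG]].
exists [set h | exists f g, [/\ F f, G g & h = f * g]]; split.
  by move=> _ [f [g [/Fh fh /Gh gh ->]]]; exact: bihomogeneousM.
rewrite setCI UF VG; apply/seteqP; split=> p.
  case=> H _ [f [g [Ff Gg ->]]]; rewrite mevalM.
    by rewrite (H f Ff) mul0r.
  by rewrite (H g Gg) mulr0.
move=> H; have [pF|] := pselect (zero_locus F p); first by left.
move=> /existsNP[f /not_implyP[Ff /eqP f0]]; right=> g Gg.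
have /eqP := H (f * g) (ex_intro _ f (ex_intro _ g (And3 Ff Gg erefl))).
by rewrite mevalM mulf_eq0 (negbTE f0) => /eqP.
Qed.

Lemma zariski_open_bigU (J : Type) (U : J -> set bipspace) :
  (forall i, zariski_open (U i)) -> zariski_open (\bigcup_i U i).
Proof.
move=> /(_ _)/cid-/all_sig[F FU].
exists (\bigcup_i F i); split=> [f [i _ Fif]|].
  exact: (FU i).1.
rewrite setC_bigcup; apply/seteqP; split=> p.
  move=> H f [i _ Fif]; have := H i I.
  by rewrite (FU i).2; exact.
by move=> H i _; rewrite (FU i).2 => f Fif; apply: H; exists i.
Qed.

HB.instance Definition _ := isOpenTopological.Build bipspace
  zariski_openT zariski_openI zariski_open_bigU.

End Zariski.

Section Conics.
Variable K : numClosedFieldType.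

Notation conic := (pspace K 5).
Notation conic_pair := (bipspace K 5 5).

(* The bijection between K^6 and the symmetric 3 x 3 matrices: v is sent to
     v0 v1 v2
     v1 v3 v4
     v2 v4 v5 *)
Definition sym_mx (v : 'rV[K]_6) : 'M[K]_3 :=
  \matrix_(i, j)
    v 0 (inord (nth 0%N (nth [::] [:: [:: 0; 1; 2]%N;
                                      [:: 1; 3; 4]%N;
                                      [:: 2; 4; 5]%N] i) j)).

Definition conic_mx (C : conic) : 'M[K]_3 := sym_mx (hcoord C).

Definition nondegenerate (C : conic) := \det (conic_mx C) != 0.

Definition on_conic (C : conic) (x : pspace K 2) :=
  hcoord x *m conic_mx C *m (hcoord x)^T = 0.

Definition transverse : set conic_pair :=
  [set p : conic_pair | [/\ nondegenerate p.1, nondegenerate p.2 &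
    [set x | on_conic p.1 x /\ on_conic p.2 x] #= `I_4]].

Definition det_pencil (C D : 'M[K]_3) : {poly K} :=
  \det ('X *: map_mx polyC C + map_mx polyC D).

Definition sigma21 C D := (det_pencil C D)`_2.
Definition sigma12 C D := (det_pencil C D)`_1.
Definition sigma03 C D := (det_pencil C D)`_0.

Definition taylor_at0 (f : K -> K) (A : nat -> K) :=
  \forall t \near (0 : K), [series A n * t ^+ n]_n @ \oo --> f t.

Definition sqrt_det_branch (C D : 'M[K]_3) (f : K -> K) :=
  \forall t \near (0 : K), f t ^+ 2 = \det (t *: C + D).

(* [taylor_at0 f A] makes f analytic near 0, so that f is an actual branch of
   the square root; that A 2 vanishes depends neither on the branch nor on the
   representatives. *)
Definition cayley_set : set conic_pair :=
  transverse `&` [set p : conic_pair | exists f A,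
    [/\ sqrt_det_branch (conic_mx p.1) (conic_mx p.2) f,
        taylor_at0 f A & A 2%N = 0]].

End Conics.

Arguments transverse {K}.
Arguments cayley_set {K}.

(* Main.v *)
Require Import Defs.
From mathcomp Require Import all_boot all_order all_algebra.
From mathcomp Require Import classical_sets reals complex.
From mathcomp Require Import generic_quotient boolp functions cardinality.
From mathcomp Require Import topology normedtype sequences.
From mathcomp Require Import -(notations) mpoly.
From mathcomp Require Import ring lra zify.

Set Implicit Arguments.
Unset Strict Implicit.
Unset Printing Implicit Defensive.

Import Order.TTheory GRing.Theory Num.Theory.
Import numFieldNormedType.Exports.

Local Open Scope classical_set_scope.
Local Open Scope card_scope.
Local Open Scope ring_scope.
Local Open Scope quotient_scope.


(** Equation. Let [A0 + A1 t + A2 t^2 + ...] be a branch of the square root of [det (tC + D)].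
    Comparing the coefficients of its square with those of the determinant gives [sigma03 = A0^2],
    [sigma12 = 2 A0 A1] and [sigma21 = 2 A0 A2 + A1^2], hence [4 sigma03 sigma21 - sigma12^2 = 8
    A0^3 A2]. Since [A0] is nonzero when [D] is nondegenerate, [A2 = 0] is exactly the Cayley
    equation ([cayley_coef]). The comparison for an arbitrary branch is [taylor_square]; that an
    analytic branch exists at all is [sqrt_series], proved by bounding the coefficients of the
    formal square root.

    Constructibility. A pair is transverse if and only if [det C], [det D] and the discriminant of
    the pencil cubic are all nonzero ([transverseE]). If they are, the two forms are diagonalised
    simultaneously and the four common points are written down. Conversely, four common points can
    be moved to the vertices of the reference triangle and the unit point, where the discriminant is
    explicit. So the transverse pairs form an open set, and the Cayley set is the intersection of
    this open set with a closed one.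

    Dimension at most 9. A chain of irreducible closed subsets of a hypersurface of P^n x P^m has
    length less than n + m ([hypersurface_chain]). A longer chain would give n + m + 1 polynomials,
    each in the next but not in the previous ideal of an increasing chain of primes. Monomials in
    such polynomials are independent ([no_relation]), yet there are more of them than the space of
    forms of their bidegree can hold ([bihom_dependent]).

    Dimension at least 9. The pairs [(g C g^T, g g^T)], with [C] in an explicit four-parameter
    family and [g] triangular, give nine parameters. Releasing them one at a time yields sets that
    are irreducible, because two of their points are joined by a polynomial curve
    ([curve_irreducible]), and whose closures grow strictly ([cayley_chain]). *)

(** * Bihomogeneous polynomials with explicit bidegree *)

Section Bihomogeneous.
Variables (K : fieldType) (n m : nat).
Local Notation poly2 := (mpoly (n.+1 + m.+1) K).
Implicit Types f g : poly2.

(** The bidegree is a parameter here because the dimension bound counts monomials of a prescribed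
    bidegree. *)
Definition bihom (a b : nat) f := forall e, e \in msupp f ->
  (\sum_(i < n.+1) e (lshift m.+1 i))%N = a /\
  (\sum_(j < m.+1) e (rshift n.+1 j))%N = b.

Lemma bihom_bihomogeneous a b f : bihom a b f -> bihomogeneous f.
Proof. by exists a, b. Qed.

Lemma bihom0 a b : bihom a b 0.
Proof. by move=> e; rewrite msupp0. Qed.

Lemma bihom1 : bihom 0 0 1.
Proof.
move=> e; rewrite msupp1 inE => /eqP ->.
by split; apply: big1 => i _; rewrite mnm0E.
Qed.

Lemma bihomD a b f g : bihom a b f -> bihom a b g -> bihom a b (f + g).
Proof.
by move=> fab gab e /msuppD_le; rewrite mem_cat => /orP[/fab|/gab].
Qed.

Lemma bihomN a b f : bihom a b f -> bihom a b (- f).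
Proof. by move=> fab e; rewrite (perm_mem (msuppN f)) => /fab. Qed.

Lemma bihomB a b f g : bihom a b f -> bihom a b g -> bihom a b (f - g).
Proof. by move=> fab gab; apply: bihomD => //; exact: bihomN. Qed.

Lemma bihomZ a b c f : bihom a b f -> bihom a b (c *: f).
Proof. by move=> fab e /msuppZ_le /fab. Qed.

Lemma bihomMn a b k f : bihom a b f -> bihom a b (f *+ k).
Proof. by rewrite -scaler_nat; exact: bihomZ. Qed.

Lemma bihomM a b c d f g :
  bihom a b f -> bihom c d g -> bihom (a + c) (b + d) (f * g).
Proof.
move=> fab gcd e /msuppM_le /allpairsP[[e1 e2] /= [/fab[<- <-] /gcd[<- <-] ->]].
by rewrite -!big_split; split; apply: eq_bigr => i _; rewrite mnmDE.
Qed.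

Lemma bihomX a b k f : bihom a b f -> bihom (k * a) (k * b) (f ^+ k).
Proof.
move=> fab; elim: k => [|k IH]; first by rewrite !mul0n; exact: bihom1.
by rewrite exprS !mulSn; exact: bihomM.
Qed.

Lemma bihom_sum (I : Type) (r : seq I) (P : pred I) (F : I -> poly2) a b :
  (forall i, P i -> bihom a b (F i)) -> bihom a b (\sum_(i <- r | P i) F i).
Proof. by move=> H; elim/big_ind: _ => //; [exact: bihom0|exact: bihomD]. Qed.

Definition varl (i : 'I_n.+1) : poly2 := mpolyX K (mnm1 (lshift m.+1 i)).
Definition varr (j : 'I_m.+1) : poly2 := mpolyX K (mnm1 (rshift n.+1 j)).

Lemma bihom_varl i : bihom 1 0 (varl i).
Proof.
move=> e; rewrite msuppX inE => /eqP ->; split.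
  rewrite (bigD1 i) //= mnm1E eqxx big1 // => j ji.
  by rewrite mnm1E (inj_eq (@lshift_inj _ _)) eq_sym (negbTE ji).
by apply: big1 => j _; rewrite mnm1E eq_lrshift.
Qed.

Lemma bihom_varr j : bihom 0 1 (varr j).
Proof.
move=> e; rewrite msuppX inE => /eqP ->; split.
  by apply: big1 => i _; rewrite mnm1E eq_rlshift.
rewrite (bigD1 j) //= mnm1E eqxx big1 // => k kj.
by rewrite mnm1E (inj_eq (@rshift_inj _ _)) eq_sym (negbTE kj).
Qed.

Definition join (u : 'rV[K]_n.+1) (v : 'rV[K]_m.+1) : 'I_(n.+1 + m.+1) -> K :=
  row_mx u v 0.

Lemma meval_varl u v i : meval (join u v) (varl i) = u 0 i.
Proof. by rewrite mevalXU /join row_mxEl. Qed.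

Lemma meval_varr u v j : meval (join u v) (varr j) = v 0 j.
Proof. by rewrite mevalXU /join row_mxEr. Qed.

Lemma bihom_scale a b f c d u v : bihom a b f ->
  meval (join (c *: u) (d *: v)) f = c ^+ a * d ^+ b * meval (join u v) f.
Proof.
move=> fab; rewrite !mevalE mulr_sumr; apply: eq_big_seq => e /fab[<- <-].
rewrite mulrCA; congr (_ * _).
rewrite !big_split_ord /= /join -!prodrXr mulrACA -!big_split /=.
by congr (_ * _); apply: eq_bigr => i _;
  rewrite ?row_mxEl ?row_mxEr mxE exprMn.
Qed.

End Bihomogeneous.

Arguments bihomX {K n m a b} k {f} _.
Arguments bihomZ {K n m a b} c {f} _.
Arguments bihomMn {K n m a b} k {f} _.
Arguments bihom_varl {K n} m i.
Arguments bihom_varr {K} n {m} j.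

(** * Points and zero loci *)

Section Points.
Variables (K : fieldType) (n : nat).
Implicit Types u v : 'rV[K]_n.+1.

Lemma const_mx1_neq0 : const_mx 1 != 0 :> 'rV[K]_n.+1.
Proof. by apply/eqP => /rowP/(_ 0)/eqP; rewrite !mxE oner_eq0. Qed.

(* the junk value [point_of 0] is the point all of whose coordinates agree *)
Definition point_of u : pspace K n :=
  \pi_(pspace K n) (insubd (exist (fun v => v != 0) _ const_mx1_neq0 : nzvec K n) u).

Lemma hcoord_neq0 (x : pspace K n) : hcoord x != 0.
Proof. exact: valP (repr x). Qed.

Lemma hcoordK : cancel (@hcoord K n) point_of.
Proof.
move=> x; rewrite /point_of -[RHS]reprK; congr (\pi _); apply: val_inj.
by rewrite insubdK //; exact: hcoord_neq0.
Qed.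

Lemma point_ofP u v : u != 0 -> v != 0 ->
  point_of u = point_of v <-> exists2 c : K, c != 0 & v = c *: u.
Proof.
move=> u0 v0; split=> [/eqquotP/asboolP[c c0]|[c c0 vE]].
  by rewrite !insubdK // => vE; exists c.
by apply/eqquotP/asboolP; exists c => //; rewrite !insubdK.
Qed.

Lemma hcoord_point u : u != 0 ->
  exists2 c : K, c != 0 & hcoord (point_of u) = c *: u.
Proof.
by move=> u0; apply/point_ofP => //; rewrite ?hcoord_neq0 ?hcoordK.
Qed.

End Points.

Section ZeroLoci.
Variables (K : fieldType) (n m : nat).
Implicit Types (f g : mpoly (n.+1 + m.+1) K) (u : 'rV[K]_n.+1) (v : 'rV[K]_m.+1).

Definition bipoint u v : bipspace K n m := (point_of u, point_of v).

Definition vanishes f (Z : set (bipspace K n m)) := Z `<=` zero_locus [set f].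

Lemma hcoordsE (p : bipspace K n m) : hcoords p = join (hcoord p.1) (hcoord p.2).
Proof. by []. Qed.

Lemma zero_locus1 f p : zero_locus [set f] p <-> meval (hcoords p) f = 0.
Proof. by split=> [/(_ f erefl)//|H _ ->]. Qed.

Lemma meval_bipoint f u v : bihomogeneous f -> u != 0 -> v != 0 ->
  (meval (hcoords (bipoint u v)) f == 0) = (meval (join u v) f == 0).
Proof.
move=> [a [b fab]] u0 v0; rewrite hcoordsE /=.
have [c c0 ->] := hcoord_point u0; have [d d0 ->] := hcoord_point v0.
by rewrite (bihom_scale _ _ _ _ fab) !mulf_eq0 !expf_eq0 (negbTE c0) (negbTE d0)
  !andbF.
Qed.

Lemma closed_zero_locus (F : set (mpoly (n.+1 + m.+1) K)) :
  (forall f, F f -> bihomogeneous f) -> closed (zero_locus F).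
Proof.
move=> Fh; rewrite -openC.
by exists F; rewrite setCK.
Qed.

Lemma closed_zero_locus1 f : bihomogeneous f -> closed (zero_locus [set f]).
Proof. by move=> fh; apply: closed_zero_locus => _ ->. Qed.

Lemma closedP (Z : set (bipspace K n m)) : closed Z ->
  exists2 F, (forall f, F f -> bihomogeneous f) & Z = zero_locus F.
Proof. by rewrite -openC => -[F [Fh]]; rewrite setCK; exists F. Qed.

Lemma closed_separate (Z : set (bipspace K n m)) p : closed Z -> ~ Z p ->
  exists f, [/\ bihomogeneous f, vanishes f Z & meval (hcoords p) f != 0].
Proof.
move=> /closedP[F Fh ->] /existsNP[f /not_implyP[Ff /eqP f0]].
exists f; split=> //; first exact: Fh.
by move=> q /(_ f Ff) /zero_locus1.
Qed.

Lemma irreducible_prime (Z : set (bipspace K n m)) f g : irreducible Z ->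
  bihomogeneous f -> bihomogeneous g -> vanishes (f * g) Z ->
  vanishes f Z \/ vanishes g Z.
Proof.
move=> [_ Zirr] fh gh fgZ; apply: Zirr; try exact: closed_zero_locus1.
move=> p /fgZ /zero_locus1; rewrite mevalM => /eqP.
by rewrite mulf_eq0 => /orP[]/eqP /zero_locus1; [left|right].
Qed.

End ZeroLoci.

(** * Chains of irreducible closed sets inside a hypersurface *)

Section KrullBound.
Variables (K : fieldType) (n m : nat).
Local Notation poly2 := (mpoly (n.+1 + m.+1) K).

(** A monomial of bidegree [(A, B)] is determined by its exponents away from the first variable of
    each block. Truncated subtraction makes some indices spurious; only surjectivity onto the
    monomials of this bidegree is claimed. *)
Definition complete_mnm (A B : nat)
    (j : {ffun 'I_n -> 'I_A.+1} * {ffun 'I_m -> 'I_B.+1}) : multinom (n.+1 + m.+1) :=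
  Multinom [tuple match fintype.split k with
    | inl i => if unlift ord0 i is Some i' then j.1 i' : nat
               else A - \sum_i' (j.1 i' : nat)
    | inr i => if unlift ord0 i is Some i' then j.2 i' : nat
               else B - \sum_i' (j.2 i' : nat)
    end | k < n.+1 + m.+1]%N.

Lemma complete_mnmP A B (e : multinom (n.+1 + m.+1)) :
  (\sum_(i < n.+1) e (lshift m.+1 i))%N = A ->
  (\sum_(j < m.+1) e (rshift n.+1 j))%N = B ->
  exists j, complete_mnm (A := A) (B := B) j = e.
Proof.
rewrite !big_ord_recl => eA eB.
have lA i : (e (lshift m.+1 (lift ord0 i)) < A.+1)%N.
  by rewrite ltnS -eA (bigD1 i) //= addnCA leq_addr.
have lB i : (e (rshift n.+1 (lift ord0 i)) < B.+1)%N.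
  by rewrite ltnS -eB (bigD1 i) //= addnCA leq_addr.
exists ([ffun i => Ordinal (lA i)], [ffun i => Ordinal (lB i)]).
apply/mnmP => k; rewrite /complete_mnm multinomE tnth_mktuple.
case: fintype.splitP => i ki.
  have -> : k = lshift m.+1 i by exact: val_inj.
  case: unliftP => [i' ->|->]; rewrite /= ?ffunE //.
  by under eq_bigr do rewrite ffunE; rewrite /= -{1}eA addnK.
have -> : k = rshift n.+1 i by exact: val_inj.
case: unliftP => [i' ->|->]; rewrite /= ?ffunE //.
by under eq_bigr do rewrite ffunE; rewrite /= -{1}eB addnK.
Qed.

(** The matrix of coefficients has more rows than columns, so its left kernel contains a nonzero
    vector. *)
Lemma bihom_dependent (I : finType) (F : I -> poly2) (A B : nat) :
  (forall i, bihom A B (F i)) -> (A.+1 ^ n * B.+1 ^ m < #|I|)%N ->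
  exists2 c : I -> K, exists i, c i != 0 & \sum_i c i *: F i = 0.
Proof.
move=> FAB ltI.
pose J : finType := ({ffun 'I_n -> 'I_A.+1} * {ffun 'I_m -> 'I_B.+1})%type.
pose M : 'M[K]_(#|I|, #|J|) :=
  \matrix_(i, j) mcoeff (complete_mnm (enum_val j)) (F (enum_val i)).
have cJ : #|J| = (A.+1 ^ n * B.+1 ^ m)%N.
  by rewrite card_prod !card_ffun !card_ord.
have : kermx M != 0.
  rewrite kermx_eq0 /row_free -leqif_eq ?rank_leq_row // neq_ltn.
  by rewrite (leq_ltn_trans (rank_leq_col _)) // cJ.
move=> /rowV0Pn[v /sub_kermxP vM v0].
exists (fun i => v 0 (enum_rank i)).
  have /rV0Pn[i vi] := v0.
  by exists (enum_val i); rewrite enum_valK.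
set S := \sum_i _.
have SAB : bihom A B S by apply: bihom_sum => i _; exact: bihomZ.
apply/mpolyP => e; rewrite mcoeff0.
have [/SAB[eA eB]|/memN_msupp_eq0//] := boolP (e \in msupp S).
have [j <-] := complete_mnmP eA eB.
have /rowP/(_ (enum_rank j)) := vM; rewrite !mxE => <-.
rewrite raddf_sum /= (reindex _ (onW_bij _ (@enum_val_bij I))) /=.
apply: eq_bigr => i _.
by rewrite mcoeffZ enum_valK mxE enum_rankK.
Qed.

(** An ideal whose primality is tested on bihomogeneous elements only: for other polynomials,
    vanishing at the chosen representatives has no geometric meaning. *)
Definition hprime (P : set poly2) := [/\ P 0,
  forall f g, P f -> P g -> P (f + g), forall f g, P g -> P (f * g) &
  forall f g, bihomogeneous f -> bihomogeneous g -> P (f * g) -> P f \/ P g].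

Fixpoint monom (fs : seq poly2) (al : seq nat) : poly2 :=
  if fs is f :: fs' then
    if al is k :: al' then f ^+ k * monom fs' al' else 1
  else 1.

Lemma bihom_monom d fs al : (forall f, f \in fs -> bihom d d f) ->
  size al = size fs -> bihom (sumn al * d) (sumn al * d) (monom fs al).
Proof.
elim: fs al => [|f fs IH] [|k al]//= Hfs; first by move=> _; exact: bihom1.
case=> /IH H; rewrite mulnDl; apply: bihomM.
  by apply: bihomX; apply: Hfs; rewrite mem_head.
by apply: H => g gfs; apply: Hfs; rewrite in_cons gfs orbT.
Qed.

(* Only the terms of [T] with lexicographically minimal exponents survive
   modulo the successive primes, and they form a single term. *)
Lemma no_relation d (fs : seq poly2) (P : nat -> set poly2) N
    (T : seq (seq nat * poly2)) :
  (forall f, f \in fs -> bihom d d f) ->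
  (forall i, (i <= size fs)%N -> hprime (P i)) ->
  (forall i, (i < size fs)%N -> P i `<=` P i.+1) ->
  (forall i, (i < size fs)%N -> P i.+1 fs`_i /\ ~ P i fs`_i) ->
  T != [::] -> uniq (unzip1 T) ->
  (forall x, x \in T -> [/\ size x.1 = size fs, ~ P (size fs) x.2 &
     exists2 k, (k + sumn x.1)%N = N & bihom (k * d) (k * d) x.2]) ->
  ~ P 0%N (\sum_(x <- T) monom fs x.1 * x.2).
Proof.
elim: fs P N T => [|f fs IH] P N T fsd Pp PS Pf T0 Tu TP /=.
  case: T T0 Tu TP => [//|[al c] [|[be c'] T]] _ /= Tu TP.
    rewrite big_seq1 mul1r.
    by case: (TP (al, c)); rewrite ?mem_head.
  case: (TP (al, c)) => [|/= + _ _]; first by rewrite mem_head.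
  case: (TP (be, c')) => [|/= + _ _]; first by rewrite !inE eqxx orbT.
  by move=> /size0nil be0 /size0nil al0; move: Tu; rewrite al0 be0 mem_head.
have exm : exists k, has (fun x => head 0%N x.1 == k) T.
  by case: T T0 {Tu TP} => [//|x T] _; exists (head 0%N x.1); rewrite /= eqxx.
(* [k] is the least exponent of [f]. The terms attaining it, stripped of [f ^+ k], form [T']; all
   others still contain [f] after division by [f ^+ k] and make up [f * R]. *)
case: (ex_minnP exm) => k /hasP[x0 x0T /eqP x0k] kmin.
have {}kmin x : x \in T -> (k <= head 0%N x.1)%N.
  by move=> xT; apply: kmin; apply/hasP; exists x.
have Tsh x : x \in T -> x.1 = head 0%N x.1 :: behead x.1.
  by case/TP; case: (x.1).
pose sel (x : seq nat * poly2) := head 0%N x.1 == k.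
pose tl (x : seq nat * poly2) := (behead x.1, x.2).
pose T' := [seq tl x | x <- T & sel x].
pose R := \sum_(x <- T | ~~ sel x)
  f ^+ (head 0%N x.1 - k).-1 * (monom fs (behead x.1) * x.2).
have fd : bihom d d f by apply: fsd; rewrite mem_head.
have fsd' g : g \in fs -> bihom d d g.
  by move=> gfs; apply: fsd; rewrite in_cons gfs orbT.
have hk (h : nat) : (k < h)%N -> h = (k.+1 + (h - k).-1)%N by lia.
have hk2 (h s l : nat) :
    (k <= h)%N -> (l + (h + s) = N)%N -> (N - k = h - k + (s + l))%N by lia.
have TE : \sum_(x <- T) monom (f :: fs) x.1 * x.2 =
          f ^+ k * (\sum_(x <- T') monom fs x.1 * x.2 + f * R).
  rewrite mulrDr big_map big_filter (bigID sel) /=; congr (_ + _).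
    rewrite mulr_sumr big_seq_cond [RHS]big_seq_cond; apply: eq_bigr => x /andP[/Tsh -> /eqP].
    by rewrite /= => ->; rewrite mulrA.
  rewrite !mulr_sumr big_seq_cond [RHS]big_seq_cond; apply: eq_bigr => x /andP[xT xk].
  rewrite {1}(Tsh _ xT) /= !mulrA -exprSr -exprD.
  congr (_ ^+ _ * _ * _); have := kmin _ xT; move: xk; rewrite /sel.
  case: ssrnat.ltngtP => // kx _ _.
  exact: hk kx.
rewrite TE => P0.
have [[P00 P0D P0M P0p] [P10 P1D P1M P1p]] : hprime (P 0%N) /\ hprime (P 1%N).
  by split; apply: Pp.
have [P1f P0f] := Pf 0%N isT.
have P0X j g : bihomogeneous g -> P 0%N (f ^+ j * g) -> P 0%N g.
  move=> gh; elim: j => [|j IHj]; first by rewrite mul1r.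
  rewrite exprS -mulrA => /P0p[||/P0f[]|/IHj//].
    exact: bihom_bihomogeneous fd.
  exact: (bihomogeneousM (bihom_bihomogeneous (bihomX j fd)) gh).
have Th x : x \in T -> bihom ((N - k) * d) ((N - k) * d)
    (f ^+ (head 0%N x.1 - k) * (monom fs (behead x.1) * x.2)).
  move=> xT; have [sx _ [l lN lh]] := TP _ xT; have := kmin _ xT.
  move: sx lN; rewrite (Tsh _ xT) /= => -[sx] lN kx.
  have -> : ((N - k) * d = (head 0%N x.1 - k) * d +
     (sumn (behead x.1) * d + l * d))%N by rewrite -!mulnDl; congr (_ * _)%N; exact: hk2 lN.
  by apply: bihomM; [exact: bihomX|apply: bihomM => //; exact: bihom_monom].
(* As [f] is not in [P 0], primality cancels [f ^+ k]; the common degree [N] keeps the cofactor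
   bihomogeneous, as primality demands. Since [f] lies in [P 1], the part [f * R] then drops out and
   a shorter relation remains for the shifted chain. *)
have : P 1%N (\sum_(x <- T') monom fs x.1 * x.2 + f * R).
  apply: PS => //; apply: P0X P0; apply: (@bihom_bihomogeneous _ _ _ ((N - k) * d) ((N - k) * d)).
  rewrite big_map big_filter mulr_sumr; apply: bihomD.
    rewrite big_seq_cond; apply: bihom_sum => x /andP[xT /eqP xk].
    by have := Th _ xT; rewrite xk subnn mul1r.
  rewrite big_seq_cond; apply: bihom_sum => x /andP[xT xk].
  rewrite mulrA -exprS prednK; first exact: Th.
  have := kmin _ xT; move: xk; rewrite /sel.
  by rewrite subn_gt0 ltn_neqAle eq_sym => -> ->.
move=> P1; have {P1} : P 1%N (\sum_(x <- T') monom fs x.1 * x.2).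
  have -> : \sum_(x <- T') monom fs x.1 * x.2 =
    \sum_(x <- T') monom fs x.1 * x.2 + f * R + (- R) * f by ring.
  by apply: P1D => //; apply: P1M.
apply: (IH (fun i => P i.+1) (N - k)%N) => //.
- by move=> i ifs; apply: Pp.
- by move=> i ifs; apply: PS.
- by move=> i ifs; apply: (Pf i.+1).
- have : tl x0 \in T' by apply: map_f; rewrite mem_filter /sel x0k eqxx.
  by apply: contraTneq => ->.
- have -> : unzip1 T' = [seq behead x | x <- unzip1 (seq.filter sel T)].
    by rewrite /unzip1 /T' -!map_comp.
  rewrite map_inj_in_uniq.
    by apply: subseq_uniq Tu; apply: map_subseq; exact: filter_subseq.
  move=> a b /mapP[x + ->] /mapP[y + ->].
  rewrite !mem_filter => /andP[/eqP xk xT] /andP[/eqP yk yT].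
  by rewrite (Tsh _ xT) (Tsh _ yT) xk yk /= => ->.
- move=> _ /mapP[x + ->]; rewrite mem_filter => /andP[/eqP xk xT].
  have [sx Px [l lN lh]] := TP _ xT; split=> //=.
    by rewrite size_behead sx.
  exists l => //; move: lN; rewrite {1}(Tsh _ xT) /= xk; lia.
Qed.

End KrullBound.

Section DimensionBound.
Variables (K : fieldType) (n m : nat).
Local Notation poly2 := (mpoly (n.+1 + m.+1) K).
Implicit Types (f g : poly2) (Z : set (bipspace K n m)).

Lemma vanishesE f Z : vanishes f Z <-> forall p, Z p -> meval (hcoords p) f = 0.
Proof. by split=> H p /H /zero_locus1. Qed.

Lemma hprime_vanishes Z : irreducible Z -> hprime (fun f => vanishes f Z).
Proof.
move=> Zirr; split.
- by apply/vanishesE => p _; rewrite meval0.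
- move=> f g /vanishesE f0 /vanishesE g0; apply/vanishesE => p Zp.
  by rewrite mevalD f0 ?g0 ?addr0.
- move=> f g /vanishesE g0; apply/vanishesE => p Zp.
  by rewrite mevalM g0 ?mulr0.
- by move=> f g fh gh; exact: irreducible_prime.
Qed.

Lemma hprime0 : hprime (fun f => f = 0).
Proof.
split=> //.
- by move=> f g -> ->; rewrite addr0.
- by move=> f g ->; rewrite mulr0.
- by move=> f g _ _ /eqP; rewrite mulf_eq0 => /orP[]/eqP; [left|right].
Qed.

Lemma hprimeX (P : set poly2) f k : hprime P -> bihomogeneous f ->
  P (f ^+ k) -> P f.
Proof.
move=> [_ _ PM Pp] [a [b fh]]; elim: k => [|k IH].
  by move/(PM f); rewrite mulr1.
rewrite exprS => /Pp[||//|//]; first exact: bihom_bihomogeneous fh.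
exact: bihom_bihomogeneous (bihomX k fh).
Qed.

(** With [r = n + m], the left side is at most [((r+1)d + 1)^r k^r = (k - 1) k^r], and [k] is chosen
    for this to be less than [k^(r+1)]. *)
Lemma dependent_count d (r := (n + m)%N) (k := ((r.+1 * d).+1 ^ r).+1) :
  ((r.+1 * k * d).+1 ^ n * (r.+1 * k * d).+1 ^ m < k ^ r.+1)%N.
Proof.
rewrite -expnD -/r.
have le1 : ((r.+1 * k * d).+1 <= (r.+1 * d).+1 * k)%N.
  by rewrite (mulnAC r.+1 k d) (mulSn (r.+1 * d)%N) -add1n leq_add2r.
apply: (@leq_ltn_trans (((r.+1 * d).+1 * k) ^ r)%N).
  have leX x y e : (x <= y -> x ^ e <= y ^ e)%N.
    by move=> xy; elim: e => // e IH; rewrite !expnS leq_mul.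
  exact: leX le1.
by rewrite expnMn expnS ltn_mul2r expn_gt0 /= ltnSn.
Qed.

(** Krull's bound by counting: together with the zero ideal, the ideals of [Z r], ..., [Z 0] would
    form a chain of [n + m + 2] primes, whose separating elements are too independent for the number
    of available monomials. *)
Lemma hypersurface_chain (A : set (bipspace K n m)) g e (Z : nat -> set _) :
  g != 0 -> bihomogeneous g -> vanishes g A -> irreducible_chain A e Z ->
  (e < n + m)%N.
Proof.
move=> g0 gh gA [Zci ZS]; rewrite ltnNge; apply/negP; set r := (n + m)%N => re.
have ZA i : (i <= e)%N -> Z i `<=` A by move=> /Zci[[F _ ->] _] p [].
have Zirr i : (i <= e)%N -> irreducible (Z i) by move=> /Zci[].
have ZleS i : (i < e)%N -> Z i `<=` Z i.+1.
  by move=> /ZS; rewrite properEneq => -[].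
have exh j : exists h : poly2, (j < r)%N ->
    [/\ bihomogeneous h, vanishes h (Z j) & ~ vanishes h (Z j.+1)].
  have [jr|//] := boolP (j < r)%N; last by exists 0.
  have je : (j < e)%N by exact: leq_trans re.
  have [[F Fcl ZE] _] := Zci j (ltnW je).
  have [_ /existsNP[q /not_implyP[Zq nZq]]] := ZS _ je.
  have nFq : ~ F q by move=> Fq; apply: nZq; rewrite ZE; split=> //; exact: ZA Zq.
  have [h [hh hF hq]] := closed_separate Fcl nFq.
  exists h => _; split=> //; first by move=> p; rewrite ZE => -[_ /hF].
  by move=> /vanishesE/(_ q Zq) /eqP; rewrite (negbTE hq).
have [h hP] := choice exh.
(* The order is reversed: [P] rises from the zero ideal through the ideal of [Z r] to that of [Z 0],
   and [F j] lies in [P j.+1] but not in [P j]. *)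
pose F j := if j is j'.+1 then h (r - j)%N else g.
pose P j : set poly2 := if j is j'.+1 then fun f => vanishes f (Z (r - j')%N)
                        else fun f => f = 0.
have Pp j : hprime (P j).
  case: j => [|j]; first exact: hprime0.
  by apply/hprime_vanishes/Zirr; rewrite (leq_trans _ re) // leq_subr.
have PS j : (j < r.+1)%N -> P j `<=` P j.+1.
  case: j => [_ f ->|j jr f]; first by case: (Pp 1%N).
  move=> + p Zp; apply; have -> : (r - j = (r - j.+1).+1)%N by lia.
  by apply: ZleS => //; lia.
have FP j : (j < r.+1)%N -> P j.+1 (F j) /\ ~ P j (F j).
  case: j => [_|j jr] /=; first split.
  - by rewrite subn0 => p /(ZA _ re) /gA.
  - by apply/eqP.
  - have [] := hP (r - j.+1)%N; first by lia.
    by have -> : (r - j = (r - j.+1).+1)%N by lia.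
have exdeg j : exists ab : nat * nat, (j < r.+1)%N -> bihom ab.1 ab.2 (F j).
  have [jr|//] := boolP (j < r.+1)%N; last by exists (0, 0)%N.
  suff [a [b fab]] : bihomogeneous (F j) by exists (a, b).
  case: j jr => [//|j] jr /=; case: (hP (r - j.+1)%N) => //; lia.
have [deg degP] := choice exdeg.
pose d := \max_(j < r.+1) maxn (deg j).1 (deg j).2.
have dP j : (j < r.+1)%N -> ((deg j).1 <= d)%N /\ ((deg j).2 <= d)%N.
  move=> jr; have := @leq_bigmax _ (fun j : 'I_r.+1 => maxn (deg j).1 (deg j).2)
    (Ordinal jr).
  by rewrite /= -/d geq_max => /andP.
(* A point of the smallest set lies on every [Z j] with [j <= r]. Coordinates [x], [y] that do not
   vanish there lie in none of the primes, so multiplying by their powers equalises bidegrees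
   without affecting membership. *)
have [[p Zp] _] := Zirr 0%N isT.
have Zlast j : (j <= r)%N -> Z j p.
  elim: j => // j IH jr; apply: ZleS (IH (ltnW jr)); exact: leq_trans re.
have /rV0Pn[a pa] := hcoord_neq0 p.1; have /rV0Pn[b pb] := hcoord_neq0 p.2.
pose x : poly2 := varl K m a; pose y : poly2 := varr K n b.
have nP j (f : poly2) : meval (hcoords p) f != 0 -> ~ P j f.
  move=> fp; case: j => [|j] /=.
    by move=> f0; rewrite f0 meval0 eqxx in fp.
  move=> /vanishesE/(_ p (Zlast _ (leq_subr _ _))) /eqP; exact/negP.
have xP j : ~ P j x by apply: nP; rewrite hcoordsE meval_varl.
have yP j : ~ P j y by apply: nP; rewrite hcoordsE meval_varr.
have xh k : bihom k 0 (x ^+ k) by have := bihomX k (bihom_varl m a); rewrite muln1 muln0.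
have yh k : bihom 0 k (y ^+ k) by have := bihomX k (bihom_varr n b); rewrite muln1 muln0.
have hbi := bihom_bihomogeneous.
pose F' j := F j * (x ^+ (d - (deg j).1) * y ^+ (d - (deg j).2)).
have F'd j : (j < r.+1)%N -> bihom d d (F' j).
  move=> jr; have [d1 d2] := dP j jr.
  have := bihomM (degP j jr) (bihomM (xh (d - (deg j).1)%N) (yh (d - (deg j).2)%N)).
  by rewrite addn0 add0n !subnKC.
pose s := x ^+ d * y ^+ d.
have sd k : bihom (k * d) (k * d) (s ^+ k).
  by apply: bihomX; have := bihomM (xh d) (yh d); rewrite addn0.
pose fs := mkseq F' r.+1.
have fsd f : f \in fs -> bihom d d f.
  by move=> /mapP[j]; rewrite mem_iota => /= jr ->; exact: F'd.
pose k := ((r.+1 * d).+1 ^ r).+1; pose N := (r.+1 * k)%N.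
pose I : finType := (r.+1.-tuple 'I_k)%type.
pose al (i : I) := [seq (val j : nat) | j <- i].
have alN i : (sumn (al i) <= N)%N.
  rewrite /al -[X in (_ <= X * _)%N](@size_tuple r.+1 'I_k i).
  elim: (tval i) => //= j t IH; rewrite mulSn leq_add //; exact: ltnW.
have sal i : size (al i) = size fs by rewrite size_map size_tuple size_mkseq.
pose M (i : I) := monom fs (al i) * s ^+ (N - sumn (al i)).
have Mh i : bihom (N * d) (N * d) (M i).
  rewrite -(subnKC (alN i)) mulnDl; apply: bihomM; last exact: sd.
  by apply: bihom_monom.
(* There are [k ^ r.+1] products [M i], all of bidegree [(N * d, N * d)], which is too many for them
   to be independent. *)
have [|c [i0 ci0] cM] := bihom_dependent Mh.
  by rewrite card_tuple card_ord; exact: dependent_count.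
pose tm (i : I) : seq nat * poly2 := (al i, c i *: s ^+ (N - sumn (al i))).
pose T := [seq tm i |
            i <- enum {: I} & c i != 0].
apply: (@no_relation _ _ _ d fs P N T) => //.
- move=> i; rewrite size_mkseq => /PS; exact.
- move=> i; rewrite size_mkseq => ir; rewrite nth_mkseq //.
  have [FP1 FP2] := FP i ir; have [d1 d2] := dP i ir.
  split; first by case: (Pp i.+1) => _ _ PM _; rewrite /F' mulrC; exact: PM.
  have [_ _ _ Pi] := Pp i.
  move=> /Pi[||//|].
  + exact: hbi (degP i ir).
  + exact: hbi (bihomM (xh _) (yh _)).
  + move=> /Pi[||/hprimeX|/hprimeX]; first exact: hbi (xh _).
    * exact: hbi (yh _).
    * by move=> /(_ (Pp i)) H; apply: (xP i); apply: H; exact: hbi (bihom_varl m a).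
    * by move=> /(_ (Pp i)) H; apply: (yP i); apply: H; exact: hbi (bihom_varr n b).
- apply/eqP => T0; have : i0 \in [seq i <- enum {: I} | c i != 0].
    by rewrite mem_filter ci0 mem_enum.
  by move: T0; rewrite /T; case: seq.filter.
- rewrite /unzip1 -map_comp map_inj_uniq; first exact/filter_uniq/enum_uniq.
  by move=> i j /= /(inj_map val_inj) /val_inj.
- move=> x0 x0T; case: (elimT mapP x0T) => i; rewrite mem_filter => /andP[ci _] ->; split; first exact: sal.
    rewrite size_mkseq; apply: nP; rewrite mevalZ mulf_neq0 // /s.
    by rewrite !rmorphXn /= mevalM !rmorphXn /= /x /y hcoordsE meval_varl meval_varr
      !(mulf_neq0, expf_neq0).
  exists (N - sumn (al i))%N; first by rewrite subnK.
  exact: bihomZ.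
- apply: etrans cM; rewrite big_map big_filter big_enum_cond big_mkcond.
  apply: eq_bigr => i _; have [->|ci] := eqVneq (c i) 0; first by rewrite scale0r.
  by rewrite -scalerAr.
Qed.

End DimensionBound.

(** * The pencil cubic, its discriminant and congruences *)

Section Pencil.

Section Ring.
Variable R : comNzRingType.
Implicit Types A B C D : 'M[R]_3.

Definition o0 : 'I_3 := @Ordinal 3 0 isT.
Definition o1 : 'I_3 := @Ordinal 3 1 isT.
Definition o2 : 'I_3 := @Ordinal 3 2 isT.

Lemma ord3P (i : 'I_3) : [\/ i = o0, i = o1 | i = o2].
Proof.
by case: i => [[|[|[|//]]] h]; [apply: Or31|apply: Or32|apply: Or33];
  exact: val_inj.
Qed.

Lemma sum3 (V : nmodType) (F : 'I_3 -> V) :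
  \sum_i F i = F o0 + F o1 + F o2.
Proof.
rewrite !big_ord_recl big_ord0 addr0 addrA.
by congr (F _ + F _ + F _); exact: val_inj.
Qed.

(* the determinant of the matrix whose rows are those of A, B and C in turn *)
Definition mixdet A B C : R :=
  A o0 o0 * (B o1 o1 * C o2 o2 - B o1 o2 * C o2 o1)
  - A o0 o1 * (B o1 o0 * C o2 o2 - B o1 o2 * C o2 o0)
  + A o0 o2 * (B o1 o0 * C o2 o1 - B o1 o1 * C o2 o0).

Lemma det3 A : \det A = mixdet A A A.
Proof.
rewrite (expand_det_row _ o0) sum3 /cofactor.
rewrite !(expand_det_row _ ord0) !big_ord_recl !big_ord0 /cofactor.
rewrite !det_mx11 !mxE /mixdet /=.
(* Reading the entries through natural indices makes differently built but equal ordinals agree by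
   computation, which lets [ring] conclude. *)
have [a aE] : exists a : nat -> nat -> R, forall i j : 'I_3, A i j = a i j.
  by exists (fun i j => A (inord i) (inord j)) => i j; rewrite !inord_val.
by rewrite !aE /= /bump /=; ring.
Qed.

End Ring.

Section PencilRing.
Variable R : comNzRingType.
Implicit Types A B C D g : 'M[R]_3.

Definition s30 C D := mixdet C C C.
Definition s21 C D := mixdet C C D + mixdet C D C + mixdet D C C.
Definition s12 C D := mixdet C D D + mixdet D C D + mixdet D D C.
Definition s03 C D := mixdet D D D.

(** The construction [det_pencil] over any commutative ring, so that it also applies to matrices of
    polynomials; [sym_of] generalises [sym_mx] for the same purpose. *)
Definition pencil C D : {poly R} :=
  \det ('X *: map_mx polyC C + map_mx polyC D).

Lemma pencilE C D : pencil C D =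
  (s30 C D)%:P * 'X^3 + (s21 C D)%:P * 'X^2 + (s12 C D)%:P * 'X + (s03 C D)%:P.
Proof.
by rewrite /pencil det3 /s30 /s21 /s12 /s03 /mixdet !mxE; ring.
Qed.

Lemma pencil_coef C D : [/\ (pencil C D)`_3 = s30 C D, (pencil C D)`_2 = s21 C D,
  (pencil C D)`_1 = s12 C D & (pencil C D)`_0 = s03 C D].
Proof.
rewrite pencilE; split; rewrite !coefD !coefCM !coefXn coefX coefC /=; ring.
Qed.

Lemma horner_pencil C D t : (pencil C D).[t] = \det (t *: C + D).
Proof.
rewrite pencilE det3 !hornerD !hornerCM !hornerXn hornerX hornerC /s30 /s21 /s12 /s03 /mixdet !mxE; ring.
Qed.

Lemma pencil_congr (g C D : 'M[R]_3) :
  pencil (g *m C *m g^T) (g *m D *m g^T) = (\det g ^+ 2)%:P * pencil C D.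
Proof.
rewrite /pencil !map_mxM -!map_trmx scalemxAl scalemxAr -mulmxDl -mulmxDr.
by rewrite !det_mulmx det_tr det_map_mx; ring.
Qed.

Lemma s_congr (g C D : 'M[R]_3) :
  let C' := g *m C *m g^T in let D' := g *m D *m g^T in
  [/\ s30 C' D' = \det g ^+ 2 * s30 C D, s21 C' D' = \det g ^+ 2 * s21 C D,
      s12 C' D' = \det g ^+ 2 * s12 C D & s03 C' D' = \det g ^+ 2 * s03 C D].
Proof.
move=> C' D'; have [<- <- <- <-] := pencil_coef C' D'.
by have [<- <- <- <-] := pencil_coef C D; rewrite pencil_congr !coefCM.
Qed.

(** The discriminant of the cubic [a t^3 + b t^2 + c t + d]. *)
Definition disc (a b c d : R) :=
  b ^+ 2 * c ^+ 2 - 4 * a * c ^+ 3 - 4 * b ^+ 3 * d - 27 * a ^+ 2 * d ^+ 2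
  + 18 * a * b * c * d.

Definition pencil_disc C D := disc (s30 C D) (s21 C D) (s12 C D) (s03 C D).

Definition cayley_eq C D := - s12 C D ^+ 2 + 4 * s03 C D * s21 C D.

(** The single equation whose non-vanishing expresses transversality, as [transverseE] shows. *)
Definition general_eq C D := s30 C D * s03 C D * pencil_disc C D.

Lemma cayley_congr g C D : cayley_eq (g *m C *m g^T) (g *m D *m g^T) =
  \det g ^+ 4 * cayley_eq C D.
Proof. by rewrite /cayley_eq; case: (s_congr g C D) => _ -> -> ->; ring. Qed.

Lemma general_congr g C D : general_eq (g *m C *m g^T) (g *m D *m g^T) =
  \det g ^+ 12 * general_eq C D.
Proof.
rewrite /general_eq /pencil_disc /disc; case: (s_congr g C D) => -> -> -> ->.
ring.
Qed.

Definition sym_of (v : 'rV[R]_6) : 'M[R]_3 :=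
  \matrix_(i, j)
    v 0 (inord (nth 0%N (nth [::] [:: [:: 0; 1; 2]%N;
                                      [:: 1; 3; 4]%N;
                                      [:: 2; 4; 5]%N] i) j)).

Definition coords_of A : 'rV[R]_6 := \row_(k < 6)
  A (inord (nth 0%N [:: 0; 0; 0; 1; 1; 2]%N k))
    (inord (nth 0%N [:: 0; 1; 2; 1; 2; 2]%N k)).

Lemma coords_ofK A : A^T = A -> sym_of (coords_of A) = A.
Proof.
move=> As; have Ac i j : A i j = A j i by rewrite -[in LHS]As mxE.
have [a [aE ac]] : exists a : nat -> nat -> R,
    (forall i j : 'I_3, A i j = a i j) /\ forall i j, a i j = a j i.
  exists (fun i j => A (inord i) (inord j)).
  by split=> i j; rewrite ?inord_val.
apply/matrixP => i j.
by case: (ord3P i) => ->; case: (ord3P j) => ->;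
  rewrite !mxE !aE /= !inordK //= !inordK //.
Qed.

Lemma sym_of_tr v : (sym_of v)^T = sym_of v.
Proof.
apply/matrixP => i j.
by case: (ord3P i) => ->; case: (ord3P j) => ->; rewrite !mxE.
Qed.

Lemma coords_of_neq0 A : A^T = A -> A != 0 -> coords_of A != 0.
Proof.
move=> As; apply: contra_neq => A0; rewrite -(coords_ofK As) A0.
by apply/matrixP => i j; rewrite !mxE.
Qed.

End PencilRing.

Section Morphism.
Variables (R S : comNzRingType) (f : {rmorphism R -> S}).
Implicit Types A B C D : 'M[R]_3.

Lemma map_mixdet A B C :
  mixdet (map_mx f A) (map_mx f B) (map_mx f C) = f (mixdet A B C).
Proof. by rewrite /mixdet !mxE; ring. Qed.

Lemma map_s C D : let C' := map_mx f C in let D' := map_mx f D in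
  [/\ s30 C' D' = f (s30 C D), s21 C' D' = f (s21 C D),
      s12 C' D' = f (s12 C D) & s03 C' D' = f (s03 C D)].
Proof. by rewrite /s30 /s21 /s12 /s03 !map_mixdet !rmorphD. Qed.

Lemma map_cayley_eq C D :
  cayley_eq (map_mx f C) (map_mx f D) = f (cayley_eq C D).
Proof. by rewrite /cayley_eq; case: (map_s C D) => _ -> -> ->; ring. Qed.

Lemma map_general_eq C D :
  general_eq (map_mx f C) (map_mx f D) = f (general_eq C D).
Proof.
rewrite /general_eq /pencil_disc /disc; case: (map_s C D) => -> -> -> ->; ring.
Qed.

Lemma map_sym_of v : map_mx f (sym_of v) = sym_of (map_mx f v).
Proof. by apply/matrixP => i j; rewrite !mxE. Qed.

Lemma map_coords_of A : map_mx f (coords_of A) = coords_of (map_mx f A).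
Proof. by apply/matrixP => i j; rewrite !mxE. Qed.

End Morphism.

End Pencil.

(** * The equations of the generic pair of conics *)

Section GenericConics.
Variable K : fieldType.
Local Notation poly2 := (mpoly (6 + 6) K).

Definition genl : 'M[poly2]_3 := sym_of (\row_(i < 6) varl K 5 i).
Definition genr : 'M[poly2]_3 := sym_of (\row_(i < 6) varr K 5 i).

Lemma map_genl u v : map_mx (meval (join u v)) genl = sym_of u.
Proof.
rewrite map_sym_of; congr sym_of; apply/rowP => i.
by rewrite !mxE /= meval_varl.
Qed.

Lemma map_genr u v : map_mx (meval (join u v)) genr = sym_of v.
Proof.
rewrite map_sym_of; congr sym_of; apply/rowP => i.
by rewrite !mxE /= meval_varr.
Qed.

Lemma bihom_genl i j : bihom 1 0 (genl i j).
Proof. by rewrite !mxE; exact: bihom_varl. Qed.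

Lemma bihom_genr i j : bihom 0 1 (genr i j).
Proof. by rewrite !mxE; exact: bihom_varr. Qed.

Lemma bihom_mixdet (A B C : 'M[poly2]_3) a b c a' b' c' :
  (forall i j, bihom a a' (A i j)) -> (forall i j, bihom b b' (B i j)) ->
  (forall i j, bihom c c' (C i j)) ->
  bihom (a + b + c) (a' + b' + c') (mixdet A B C).
Proof.
move=> HA HB HC; rewrite -!addnA.
by do ![apply: bihomB|apply: bihomD|apply: bihomM|done].
Qed.

Lemma bihom_s : [/\ bihom 3 0 (s30 genl genr), bihom 2 1 (s21 genl genr),
  bihom 1 2 (s12 genl genr) & bihom 0 3 (s03 genl genr)].
Proof.
have [l r] := (bihom_genl, bihom_genr).
split; first exact: (bihom_mixdet l l l); last exact: (bihom_mixdet r r r).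
  apply: bihomD; first apply: bihomD.
  - exact: (bihom_mixdet l l r).
  - exact: (bihom_mixdet l r l).
  - exact: (bihom_mixdet r l l).
apply: bihomD; first apply: bihomD.
- exact: (bihom_mixdet l r r).
- exact: (bihom_mixdet r l r).
- exact: (bihom_mixdet r r l).
Qed.

Lemma bihom_cayley_eq : bihomogeneous (cayley_eq genl genr).
Proof.
have [_ h21 h12 h03] := bihom_s.
apply: (@bihom_bihomogeneous _ _ _ 2 4); apply: bihomD.
  by apply: bihomN; exact: (bihomX 2 h12).
rewrite -mulrA mulr_natl; apply: bihomMn; exact: (bihomM h03 h21).
Qed.

Lemma bihom_general_eq : bihomogeneous (general_eq genl genr).
Proof.
have [h30 h21 h12 h03] := bihom_s.
apply: bihomogeneousM.
  by apply: bihom_bihomogeneous; exact: (bihomM h30 h03).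
apply: (@bihom_bihomogeneous _ _ _ 6 6).
rewrite /pencil_disc /disc; move: (s30 _ _) (s21 _ _) (s12 _ _) (s03 _ _) h30 h21 h12 h03.
move=> a b c d ha hb hc hd.
rewrite -!mulrA !mulr_natl; apply: bihomD; last first.
  by apply: bihomMn; exact: (bihomM ha (bihomM hb (bihomM hc hd))).
do 3?[apply: bihomB]; try apply: bihomMn.
- exact: (bihomM hb (bihomM hb (bihomX 2 hc))).
- exact: (bihomM ha (bihomX 3 hc)).
- exact: (bihomM hb (bihomM hb (bihomM hb hd))).
- exact: (bihomM ha (bihomM ha (bihomX 2 hd))).
Qed.

Lemma meval_cayley_eq u v :
  meval (join u v) (cayley_eq genl genr) = cayley_eq (sym_of u) (sym_of v).
Proof. by rewrite -map_cayley_eq map_genl map_genr. Qed.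

Lemma meval_general_eq u v :
  meval (join u v) (general_eq genl genr) = general_eq (sym_of u) (sym_of v).
Proof. by rewrite -map_general_eq map_genl map_genr. Qed.

End GenericConics.

(** * Common isotropic lines of two symmetric forms *)

Section BilinearForm.
Variable K : fieldType.
Implicit Types (C D g : 'M[K]_3) (x y : 'rV[K]_3).

Definition bil C x y : K := (x *m C *m y^T) 0 0.

Lemma bilE C x y : bil C x y =
  (x 0 o0 * C o0 o0 + x 0 o1 * C o1 o0 + x 0 o2 * C o2 o0) * y 0 o0 +
  (x 0 o0 * C o0 o1 + x 0 o1 * C o1 o1 + x 0 o2 * C o2 o1) * y 0 o1 +
  (x 0 o0 * C o0 o2 + x 0 o1 * C o1 o2 + x 0 o2 * C o2 o2) * y 0 o2.
Proof. by rewrite /bil !mxE sum3 !mxE !sum3. Qed.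

Lemma bilDl C x x' y : bil C (x + x') y = bil C x y + bil C x' y.
Proof. by rewrite /bil !mulmxDl mxE. Qed.

Lemma bilZl C a x y : bil C (a *: x) y = a * bil C x y.
Proof. by rewrite /bil -!scalemxAl mxE. Qed.

Lemma bilDr C x y y' : bil C x (y + y') = bil C x y + bil C x y'.
Proof. by rewrite /bil linearD /= mulmxDr mxE. Qed.

Lemma bilZr C a x y : bil C x (a *: y) = a * bil C x y.
Proof. by rewrite /bil linearZ /= -scalemxAr mxE. Qed.

Lemma bilC C x y : C^T = C -> bil C x y = bil C y x.
Proof.
move=> Cs; rewrite /bil -[in RHS](trmxK (y *m C *m x^T)) [in RHS]mxE.
by rewrite !trmx_mul trmxK Cs mulmxA.
Qed.

Lemma bil_congr g C x y : bil (g *m C *m g^T) x y = bil C (x *m g) (y *m g).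
Proof. by rewrite /bil trmx_mul !mulmxA. Qed.

Lemma gram_entry g C i j :
  (g *m C *m g^T) i j = bil C (row i g) (row j g).
Proof.
rewrite /bil -row_mul tr_row mxE [RHS]mxE.
by apply: eq_bigr => k _; rewrite !mxE.
Qed.

Definition isotropic C D x := bil C x x = 0 /\ bil D x x = 0.

Lemma isotropicZ C D a x : a != 0 ->
  isotropic C D (a *: x) <-> isotropic C D x.
Proof.
move=> a0; rewrite /isotropic !bilZl !bilZr; split=> [[eC eD]|[-> ->]]; last by rewrite !mulr0.
by split; apply: (mulfI a0); apply: (mulfI a0); rewrite !mulr0.
Qed.

(** The four common points, expressed by vectors instead of points so that a change of basis acts on
    them by multiplication ([four_lines_congr]). Only the values [w k] with [k < 4] matter. *)
Definition four_lines C D := exists w : nat -> 'rV[K]_3,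
  [/\ forall k, (k < 4)%N -> w k != 0 /\ isotropic C D (w k),
      forall k l a, (k < 4)%N -> (l < 4)%N -> w k = a *: w l -> k = l &
      forall x, x != 0 -> isotropic C D x ->
        exists k a, (k < 4)%N /\ x = a *: w k].

Lemma four_lines_congr g C D : g \in unitmx ->
  four_lines (g *m C *m g^T) (g *m D *m g^T) -> four_lines C D.
Proof.
move=> gu [w [wi winj wall]]; exists (fun k => w k *m g).
have mulgI x y : x *m g = y *m g -> x = y.
  by move/(congr1 (fun z => z *m invmx g)); rewrite !mulmxK.
split=> [k /wi[wk0 [wC wD]]|k l a kn ln|x x0 [xC xD]].
- split; last by rewrite /isotropic -!bil_congr.
  by apply: contra_neq wk0 => wg; apply: mulgI; rewrite mul0mx.
- by rewrite scalemxAl => /mulgI; exact: winj.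
- have [||k [a [kn xE]]] := wall (x *m invmx g).
  + by apply: contra_neq x0 => xg; rewrite -(mulmxKV gu x) xg mul0mx.
  + by rewrite /isotropic !bil_congr mulmxKV.
  + by exists k, a; rewrite scalemxAl -xE mulmxKV.
Qed.

Lemma four_linesP C D :
  [set x : pspace K 2 | isotropic C D (hcoord x)] #= `I_4 <-> four_lines C D.
Proof.
split=> [/card_set_bijP[f [fS finj fsurj]]|[w [wi winj wall]]].
  have exh k : exists x : pspace K 2, (k < 4)%N -> isotropic C D (hcoord x) /\ f x = k.
    have [k4|k4] := boolP (k < 4)%N; last by exists (point_of 0).
    by have [x /= xi fx] := fsurj k k4; exists x.
  have [h hP] := choice exh.
  exists (fun k => hcoord (h k)); split=> [k kn|k l a kn ln e|x x0 xi].
  - by split; [exact: hcoord_neq0|case: (hP k kn)].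
  - have [_ <-] := hP k kn; have [_ <-] := hP l ln; congr f.
    rewrite -(hcoordK (h k)) -(hcoordK (h l)); apply/esym/point_ofP; rewrite ?hcoord_neq0 //.
    exists a => //; apply: contra_neq (hcoord_neq0 (h k)) => a0.
    by rewrite e a0 scale0r.
  - have [c c0 cE] := hcoord_point x0.
    have Sx : isotropic C D (hcoord (point_of x)) by rewrite cE; apply/isotropicZ.
    exists (f (point_of x)), c^-1; split; first exact: fS.
    have [hi fh] := hP _ (fS _ Sx).
    have -> : h (f (point_of x)) = point_of x by apply: finj; rewrite ?inE.
    by rewrite cE scalerA mulVf // scale1r.
have -> : [set x : pspace K 2 | isotropic C D (hcoord x)] =
          (fun k => point_of (w k)) @` `I_4.
  apply/seteqP; split=> [x /= xi|_ [k /= /wi[wk0 wki] <-] /=].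
    have [k [a [kn xE]]] := wall _ (hcoord_neq0 x) xi; exists k => //.
    rewrite -[RHS]hcoordK; apply/point_ofP; rewrite ?hcoord_neq0 //; first by case: (wi k kn).
    exists a => //; apply: contra_neq (hcoord_neq0 x) => a0.
    by rewrite xE a0 scale0r.
  have [c c0 ->] := hcoord_point wk0; exact/isotropicZ.
apply: inj_card_eq => k l.
rewrite !inE /= => kn ln /point_ofP H.
have [||c _ e] := H; first by case: (wi k kn).
  by case: (wi l ln).
by apply/esym/(winj l k c).
Qed.

End BilinearForm.

Definition vec3 (K : nzRingType) (a b c : K) : 'rV[K]_3 :=
  \row_j [:: a; b; c]`_j.

Lemma vec3E (K : nzRingType) (x : 'rV[K]_3) :
  x = vec3 (x 0 o0) (x 0 o1) (x 0 o2).
Proof. by apply/rowP => j; rewrite mxE; case: (ord3P j) => ->. Qed.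

Lemma mulmx_vec3 (K : comNzRingType) (a b c : K) (g : 'M[K]_3) :
  vec3 a b c *m g = a *: row o0 g + b *: row o1 g + c *: row o2 g.
Proof. by rewrite mulmx_sum_row sum3 !mxE. Qed.

(** * A nonzero discriminant gives four common points *)

Section Transversality.
Variable K : numClosedFieldType.
Implicit Types (C D g : 'M[K]_3) (x y : 'rV[K]_3).

Lemma disc_roots (a t0 t1 t2 : K) :
  disc a (- a * (t0 + t1 + t2)) (a * (t0 * t1 + t1 * t2 + t2 * t0))
    (- a * (t0 * t1 * t2)) =
  a ^+ 4 * ((t0 - t1) * (t1 - t2) * (t2 - t0)) ^+ 2.
Proof. by rewrite /disc; ring. Qed.

Lemma pencil_roots C D : s30 C D != 0 ->
  exists t : 'I_3 -> K, (forall i, \det (t i *: C + D) = 0) /\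
    pencil_disc C D = s30 C D ^+ 4 *
      ((t o0 - t o1) * (t o1 - t o2) * (t o2 - t o0)) ^+ 2.
Proof.
move=> a0; set a := s30 C D in a0 *.
have [c3 c2 c1 c0] := pencil_coef C D.
have sz : size (pencil C D) = 4%N.
  apply/eqP; rewrite eqn_leq; apply/andP; split.
    apply/leq_sizeP => j j4; rewrite pencilE !coefD !coefCM !coefXn coefX coefC.
    by case: j j4 => [|[|[|[|j]]]] //= _; rewrite !mulr0 !addr0.
  by rewrite ltnNge; apply/negP => /leq_sizeP/(_ 3%N (leqnn _)) /eqP;
     rewrite c3 (negbTE a0).
have lc : lead_coef (pencil C D) = a by rewrite lead_coefE sz c3.
have [r rE] := closed_field_poly_normal (pencil C D).
have := sz; rewrite {1}rE lc size_scale // size_prod_XsubC => -[].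
case: r rE => [|t0 [|t1 [|t2 [|//]]]] //; rewrite lc => rE _.
pose t (i : 'I_3) := [:: t0; t1; t2]`_i.
exists t; split=> [i|].
  rewrite -horner_pencil rE !big_cons big_nil mulr1 hornerZ !hornerM !hornerXsubC.
  by case: (ord3P i) => ->; rewrite /t /= subrr ?(mul0r, mulr0).
rewrite /t /= -disc_roots.
have rE' : pencil C D = a%:P * 'X^3 + (- a * (t0 + t1 + t2))%:P * 'X^2 +
    (a * (t0 * t1 + t1 * t2 + t2 * t0))%:P * 'X + (- a * (t0 * t1 * t2))%:P.
  by rewrite rE !big_cons big_nil -mul_polyC; ring.
rewrite /pencil_disc -/a -c2 -c1 -c0 rE'.
by rewrite !coefD !coefCM !coefXn !coefX !coefC /= !(mulr0, mulr1, addr0, add0r).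
Qed.

(** Each of the three distinct roots [t i] gives a vector [v i] in the left kernel of
    [t i *: C + D]. Two of them are orthogonal for both forms because [t i != t j], and together
    they form a basis that diagonalises both. *)
Lemma pencil_basis C D : C^T = C -> D^T = D -> general_eq C D != 0 ->
  exists (g : 'M[K]_3) (c t : 'I_3 -> K),
  [/\ g \in unitmx,
      forall i j, (g *m C *m g^T) i j = c i *+ (i == j),
      forall i j, (g *m D *m g^T) i j = (- t i * c i) *+ (i == j),
      forall i, c i != 0 & [/\ t o0 != t o1, t o1 != t o2 & t o2 != t o0]].
Proof.
move=> Cs Ds; rewrite /general_eq !mulf_eq0 !negb_or => /andP[/andP[a0 _]].
have [t [tdet ->]] := pencil_roots a0.
rewrite mulf_eq0 !expf_eq0 /= !mulf_eq0 !negb_or !subr_eq0.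
move=> /andP[_ /andP[/andP[t01 t12] t20]].
have Cu : C \in unitmx by rewrite unitmxE unitfE det3.
have /choice[v vP] i : exists v : 'rV[K]_3, v != 0 /\ v *m (t i *: C + D) = 0.
  by have /eqP/det0P[v v0 vE] := tdet i; exists v.
have vD i : v i *m D = - t i *: (v i *m C).
  have [_ ] := vP i; rewrite mulmxDr -scalemxAr => /eqP.
  by rewrite addrC addr_eq0 -scaleNr => /eqP.
pose g : 'M[K]_3 := \matrix_i v i.
have rg i : row i g = v i by rewrite rowK.
have tinj i j : i != j -> t i != t j.
  case: (ord3P i) => ->; case: (ord3P j) => ->; rewrite ?eqxx // => _ //;
    by rewrite eq_sym.
have orth i j : i != j -> bil C (v i) (v j) = 0.
  move=> /tinj tij.
  have e1 : bil D (v i) (v j) = - t i * bil C (v i) (v j).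
    by rewrite /bil vD -scalemxAl mxE.
  have e2 : bil D (v j) (v i) = - t j * bil C (v j) (v i).
    by rewrite /bil vD -scalemxAl mxE.
  move: e2; rewrite (bilC _ _ Ds) (bilC _ _ Cs) e1 => /eqP.
  rewrite -subr_eq0 -mulrBl mulf_eq0 opprK addrC subr_eq0 eq_sym (negbTE tij).
  by move=> /eqP.
have gu : g \in unitmx.
  rewrite unitmxE unitfE; apply/det0P => -[u u0 /eqP]; rewrite mulmx_sum_row => /eqP ug.
  pose M s := (s *: C + D) *m invmx C.
  have vM s i : v i *m M s = (s - t i) *: v i.
    rewrite mulmxA mulmxDr -scalemxAr vD -scalerDl scalemxAl -mulmxA mulmxV //.
    by rewrite mulmx1.
  (* Lagrange interpolation: [v i] is an eigenvector of [M s] for [s - t i], so applying [M (t i)]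
     and [M (t j)] to a linear relation leaves only the third term. *)
  have uM s1 s2 : \sum_i (u 0 i * ((s1 - t i) * (s2 - t i))) *: v i = 0.
    transitivity (\sum_i u 0 i *: row i g *m M s1 *m M s2); last by rewrite -!mulmx_suml ug !mul0mx.
    apply: eq_bigr => i _.
    by rewrite rg -!scalemxAl vM -scalemxAl vM !scalerA; congr (_ *: _); ring.
  have u1 i j k : t k != t i -> t k != t j ->
      \sum_l (u 0 l * ((t i - t l) * (t j - t l))) *: v l =
      (u 0 k * ((t i - t k) * (t j - t k))) *: v k -> u 0 k = 0.
    move=> ki kj; rewrite uM => /esym/eqP; rewrite scaler_eq0 (negbTE (vP k).1) orbF.
    rewrite !mulf_eq0 !subr_eq0 ![t _ == t k]eq_sym (negbTE ki) (negbTE kj) !orbF.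
    by move=> /eqP.
  apply/negP: u0; rewrite negbK; apply/eqP/rowP => k; rewrite [RHS]mxE.
  by case: (ord3P k) => ->; [apply: (u1 o1 o2)|apply: (u1 o0 o2)|apply: (u1 o0 o1)];
    rewrite ?sum3 ?subrr ?(mulr0, mul0r, scale0r, addr0, add0r) // eq_sym.
pose c i := bil C (v i) (v i).
have gC i j : (g *m C *m g^T) i j = c i *+ (i == j).
  rewrite gram_entry !rg; have [->//|/orth ->//] := eqVneq i j.
exists g, c, t; split=> //.
- move=> i j; rewrite gram_entry !rg /bil vD -scalemxAl mxE -/(bil _ _ _).
  have [->//|/orth ->] := eqVneq i j; by rewrite mulr0.
- move=> i; apply: contra_neq (a0) => ci.
  have : \det (g *m C *m g^T) = 0.
    rewrite det3 /mixdet !gC /= !mulr0n.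
    by case: (ord3P i) ci => -> ->; rewrite !(mulr0, mul0r, subr0, addr0).
  have gd : \det g != 0 by move: gu; rewrite unitmxE unitfE.
  rewrite !det_mulmx det_tr => /eqP.
  by rewrite !mulf_eq0 (negbTE gd) /= orbF det3 => /eqP.
Qed.

(** In the unknowns [z i = c i * x i ^ 2] the two equations are linear, and their solutions are the
    multiples of [(t1 - t2, t2 - t0, t0 - t1)], whose entries are nonzero. Taking square roots
    leaves three signs, hence four points up to a common sign. *)
Lemma diagonal_four_lines (A B : 'M[K]_3) (c t : 'I_3 -> K) :
  (forall i j, A i j = c i *+ (i == j)) ->
  (forall i j, B i j = (- t i * c i) *+ (i == j)) ->
  (forall i, c i != 0) -> [/\ t o0 != t o1, t o1 != t o2 & t o2 != t o0] ->
  four_lines A B.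
Proof.
move=> AE BE c0 [t01 t12 t20].
have [[cn0 cn1] cn2] := (c0 o0, c0 o1, c0 o2).
pose s0 := sqrtC ((t o1 - t o2) / c o0).
pose s1 := sqrtC ((t o2 - t o0) / c o1).
pose s2 := sqrtC ((t o0 - t o1) / c o2).
have e0 : c o0 * s0 ^+ 2 = t o1 - t o2 by rewrite sqrtCK mulrC divfK.
have e1 : c o1 * s1 ^+ 2 = t o2 - t o0 by rewrite sqrtCK mulrC divfK.
have e2 : c o2 * s2 ^+ 2 = t o0 - t o1 by rewrite sqrtCK mulrC divfK.
have n0 : s0 != 0 by rewrite sqrtC_eq0 mulf_neq0 ?invr_eq0 // subr_eq0.
have n1 : s1 != 0 by rewrite sqrtC_eq0 mulf_neq0 ?invr_eq0 // subr_eq0.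
have n2 : s2 != 0 by rewrite sqrtC_eq0 mulf_neq0 ?invr_eq0 // subr_eq0.
have isoE x : isotropic A B x <->
    c o0 * x 0 o0 ^+ 2 + c o1 * x 0 o1 ^+ 2 + c o2 * x 0 o2 ^+ 2 = 0 /\
    t o0 * (c o0 * x 0 o0 ^+ 2) + t o1 * (c o1 * x 0 o1 ^+ 2)
      + t o2 * (c o2 * x 0 o2 ^+ 2) = 0.
  rewrite /isotropic !bilE !AE !BE /= !mulr0n !mulr1n.
  split=> -[qA qB]; split.
  - by rewrite -[RHS]qA; ring.
  - by apply/eqP; rewrite -oppr_eq0; apply/eqP; rewrite -[RHS]qB; ring.
  - by rewrite -[RHS]qA; ring.
  - by apply/eqP; rewrite -oppr_eq0; apply/eqP; rewrite -[RHS]qB; ring.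
(* The two binary digits of [k] are the signs of the first two coordinates; the last one is
   normalised to [s2]. *)
pose w (k : nat) := vec3 ((-1) ^+ odd k * s0) ((-1) ^+ (1 < k)%N * s1) s2.
have wE k : [/\ w k 0 o0 = (-1) ^+ odd k * s0,
    w k 0 o1 = (-1) ^+ (1 < k)%N * s1 & w k 0 o2 = s2] by rewrite !mxE.
exists w; split=> [k k4|k l a k4 l4 e|x x0 /isoE[q1 q2]].
- have [w0 w1 w2] := wE k; split.
    by apply: contra_neq n2 => wk; rewrite -w2 wk mxE.
  apply/isoE; rewrite w0 w1 w2 !exprMn !sqrr_sign !mul1r e0 e1 e2; split; ring.
- have [w0 w1 w2] := wE k; have [w0' w1' w2'] := wE l.
  move: w0 w1 w2; rewrite e !mxE /= => w0 w1 w2.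
  have a1 : a = 1 by apply: (mulIf n2); rewrite w2 mul1r.
  move: w0 w1; rewrite a1 !mul1r => /(mulIf n0) w0 /(mulIf n1) w1.
  have signI (b b' : bool) : (-1) ^+ b = (-1) ^+ b' :> K -> b = b'.
    by move/eqP; rewrite (inj_eq (@signr_inj K)) => /eqP.
  move: w0 w1 => /signI + /signI.
  clear - k4 l4; by case: k k4 => [|[|[|[|//]]]] _; case: l l4 => [|[|[|[|//]]]].
- set z0 := c o0 * _ in q1 q2; set z1 := c o1 * _ in q1 q2.
  set z2 := c o2 * _ in q1 q2.
  have z0E : z0 * (t o0 - t o1) = z2 * (t o1 - t o2).
    apply/eqP; rewrite -subr_eq0; apply/eqP.
    transitivity (t o0 * z0 + t o1 * z1 + t o2 * z2 - t o1 * (z0 + z1 + z2)).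
      by ring.
    by rewrite q1 q2; ring.
  have z1E : z1 * (t o0 - t o1) = z2 * (t o2 - t o0).
    apply/eqP; rewrite -subr_eq0; apply/eqP.
    transitivity (t o0 * (z0 + z1 + z2) - (t o0 * z0 + t o1 * z1 + t o2 * z2)).
      by ring.
    by rewrite q1 q2; ring.
  have y2 : x 0 o2 != 0.
    apply/eqP => y2; have z20 : z2 = 0 by rewrite /z2 y2 expr0n mulr0.
    have zz z i : z = c i * x 0 i ^+ 2 -> z * (t o0 - t o1) = 0 -> x 0 i = 0.
      move=> -> /eqP; rewrite !mulf_eq0 subr_eq0 (negbTE t01) (negbTE (c0 i)) /= orbF.
      by rewrite orbb => /eqP.
    apply/negP: x0; rewrite negbK; apply/eqP/rowP => i; rewrite [RHS]mxE.
    case: (ord3P i) => -> //; first by apply: (zz z0); rewrite // z0E z20 mul0r.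
    by apply: (zz z1); rewrite // z1E z20 mul0r.
  (* Rescaling [x] to last coordinate [s2] determines the squares of the other two. *)
  pose la := s2 / x 0 o2.
  have la0 : la != 0 by rewrite mulf_neq0 ?invr_eq0.
  have sq i s z r : z = c i * x 0 i ^+ 2 -> c i * s ^+ 2 = r ->
      z * (t o0 - t o1) = z2 * r -> exists b : bool, la * x 0 i = (-1) ^+ b * s.
    move=> zE sE zr.
    have : (la * x 0 i) ^+ 2 == s ^+ 2.
      apply/eqP; apply: (mulfI (c0 i)); apply: (mulIf (x := z2)).
        by rewrite mulf_neq0 // expf_neq0.
      rewrite sE [r * _]mulrC -zr -e2 zE /z2 /la !exprMn exprVn.
      by field.
    rewrite eqf_sqr => /orP[]/eqP ->.
      by exists false; rewrite mul1r.
    by exists true; rewrite mulN1r.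
  have [b0 h0] := sq o0 s0 z0 _ erefl e0 z0E.
  have [b1 h1] := sq o1 s1 z1 _ erefl e1 z1E.
  exists (b0 + b1.*2)%N, la^-1; split; first by case: b0 {h0}; case: b1 {h1}.
  apply: (scalerI la0); rewrite scalerA divff // scale1r.
  have [w0 w1 w2] := wE (b0 + b1.*2)%N.
  rewrite [LHS]vec3E [RHS]vec3E w0 w1 w2 !mxE h0 h1.
  have -> : odd (b0 + b1.*2) = b0 by rewrite oddD odd_double addbF oddb.
  have -> : (1 < b0 + b1.*2)%N = b1 by case: (b0); case: (b1).
  by rewrite /la divfK.
Qed.

Lemma general_four_lines C D : C^T = C -> D^T = D -> general_eq C D != 0 ->
  four_lines C D.
Proof.
move=> Cs Ds /(pencil_basis Cs Ds)[g [c [t [gu gC gD c0 tt]]]].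
exact: four_lines_congr gu (diagonal_four_lines gC gD c0 tt).
Qed.

End Transversality.

(** * Four common points give a nonzero discriminant *)

Section Converse.
Variable K : numClosedFieldType.
Implicit Types (C D g : 'M[K]_3) (x y : 'rV[K]_3).

Lemma congr_sym g C : C^T = C -> (g *m C *m g^T)^T = g *m C *m g^T.
Proof. by move=> Cs; rewrite !trmx_mul trmxK Cs mulmxA. Qed.

(* Otherwise they would span a totally isotropic plane. *)
Lemma bil_isotropic_neq0 C x y : C^T = C -> \det C != 0 ->
  bil C x x = 0 -> bil C y y = 0 -> y != 0 -> (forall a, x != a *: y) ->
  bil C x y != 0.
Proof.
move=> Cs C0 xx yy y0 xy; apply/eqP => bxy.
pose U : 'M[K]_(1 + 1, 3) := col_mx x y.
have UCU : (U *m C) *m U^T = 0.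
  have z (u v : 'rV[K]_3) : bil C u v = 0 -> u *m C *m v^T = 0.
    by move=> uv; apply/matrixP => i j; rewrite !ord1 [RHS]mxE.
  rewrite /U mul_col_mx tr_col_mx mul_col_row !z ?(bilC y) //.
  by rewrite /block_mx !row_mx0 col_mx0.
have Ufree : row_free U.
  rewrite -kermx_eq0; apply/rowV0P => u /sub_kermxP.
  rewrite -(hsubmxK u) mul_row_col (mx11_scalar (lsubmx u)) (mx11_scalar (rsubmx u)).
  move: (lsubmx u 0 0) (rsubmx u 0 0) => a b; rewrite !mul_scalar_mx => ab.
  have a0 : a = 0.
    apply/eqP; apply/negPn/negP => a0; move: (xy (- b / a)); apply/negP.
    rewrite negbK; apply/eqP; apply: (scalerI a0); rewrite scalerA mulrCA divff //.
    by rewrite mulr1 scaleNr; apply/eqP; rewrite -addr_eq0 ab.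
  move/eqP: ab; rewrite a0 scale0r add0r scaler_eq0 (negbTE y0) orbF => /eqP ->.
  by rewrite raddf0 row_mx0.
have := mulmx0_rank_max UCU.
rewrite mxrank_tr mxrankMfree; first by rewrite (eqP Ufree).
by rewrite row_free_unit unitmxE unitfE.
Qed.

(** The triangle vertices and the unit point lie on both conics, so each matrix has off-diagonal
    entries of sum zero and the discriminant is [16 (a b' - a' b)^6]. If it vanished, every point of
    the first conic would lie on the second, giving a fifth common point. *)
Lemma zero_diagonal_pencil (A B : 'M[K]_3) : A^T = A -> B^T = B ->
  (forall i, A i i = 0) -> (forall i, B i i = 0) ->
  isotropic A B (const_mx 1) -> s30 A B != 0 -> s03 A B != 0 -> four_lines A B ->
  general_eq A B != 0.
Proof.
move=> As Bs Ad Bd [iA iB] sA sB fl.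
have Ac i j : A i j = A j i by rewrite -[in LHS]As mxE.
have Bc i j : B i j = B j i by rewrite -[in LHS]Bs mxE.
pose a := A o0 o1; pose b := A o0 o2; pose c := A o1 o2.
pose a' := B o0 o1; pose b' := B o0 o2; pose c' := B o1 o2.
have sums (X Y Z : K) : 2 * (X + Y + Z) = 0 -> Z = - X - Y.
  move=> /eqP; rewrite mulf_eq0 pnatr_eq0 /= => /eqP e.
  by apply/eqP; rewrite -subr_eq0 -e; apply/eqP; ring.
have cE : c = - a - b.
  apply: sums; rewrite -[RHS]iA bilE !mxE !Ad -/a -/b -/c.
  by rewrite (Ac o1 o0) (Ac o2 o0) (Ac o2 o1) -/a -/b -/c; ring.
have cE' : c' = - a' - b'.
  apply: sums; rewrite -[RHS]iB bilE !mxE !Bd -/a' -/b' -/c'.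
  by rewrite (Bc o1 o0) (Bc o2 o0) (Bc o2 o1) -/a' -/b' -/c'; ring.
have isoA x : bil A x x = 2 * (a * x 0 o0 * x 0 o1 + b * x 0 o0 * x 0 o2 +
    c * x 0 o1 * x 0 o2).
  by rewrite bilE !Ad (Ac o1 o0) (Ac o2 o0) (Ac o2 o1) -/a -/b -/c; ring.
have isoB x : bil B x x = 2 * (a' * x 0 o0 * x 0 o1 + b' * x 0 o0 * x 0 o2 +
    c' * x 0 o1 * x 0 o2).
  by rewrite bilE !Bd (Bc o1 o0) (Bc o2 o0) (Bc o2 o1) -/a' -/b' -/c'; ring.
have sE : [/\ s30 A B = 2 * a * b * c,
    s21 A B = 2 * (a * b * c' + a * b' * c + a' * b * c),
    s12 A B = 2 * (a * b' * c' + a' * b * c' + a' * b' * c) &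
    s03 A B = 2 * a' * b' * c'].
  rewrite /s30 /s21 /s12 /s03 /mixdet !Ad !Bd (Ac o1 o0) (Ac o2 o0) (Ac o2 o1).
  rewrite (Bc o1 o0) (Bc o2 o0) (Bc o2 o1) -/a -/b -/c -/a' -/b' -/c'.
  by split; ring.
have [e30 e21 e12 e03] := sE.
have dE : pencil_disc A B = 16 *
    ((a * b' - a' * b) * (a * c' - a' * c) * (b * c' - b' * c)) ^+ 2.
  by rewrite /pencil_disc /disc e30 e21 e12 e03; ring.
rewrite /general_eq !mulf_neq0 // dE.
rewrite mulf_neq0 ?pnatr_eq0 // expf_neq0 // cE cE'.
have -> : (a * b' - a' * b) * (a * (- a' - b') - a' * (- a - b)) *
    (b * (- a' - b') - b' * (- a - b)) = - (a * b' - a' * b) ^+ 3 by ring.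
rewrite oppr_eq0 expf_neq0 // subr_eq0; apply/eqP => ab.
move: sA; rewrite e30 !mulf_eq0 !negb_or pnatr_eq0 /= => /andP[/andP[a0 b0] c0].
have [w [wi winj wall]] := fl.
(* a fifth point on the conic [a x y + b x z + c y z = 0] *)
have [y [y0 y1 by0]] : exists y : K, [/\ y != 0, y != 1 & b + c * y != 0].
  have [e|e] := eqVneq (b - c) 0.
    exists 2; split; rewrite ?pnatr_eq0 ?pnatr_eq1 //.
    have -> : b + c * 2 = 3 * c + (b - c) by ring.
    by rewrite e addr0 mulf_neq0 // pnatr_eq0.
  exists (-1); split; rewrite ?oppr_eq0 ?oner_eq0 ?mulrN1 //.
  by rewrite eqNr oner_eq0.
(* The point of the conic whose first two coordinates have ratio [y]. The conditions on [y] make all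
   coordinates nonzero and keep [v] away from the unit point. *)
pose v := vec3 (b + c * y) (y * (b + c * y)) (- (a * y)).
have vn0 : v 0 o0 != 0 by rewrite mxE.
have vn1 : v 0 o1 != 0 by rewrite mxE mulf_neq0.
have vn2 : v 0 o2 != 0 by rewrite mxE oppr_eq0 mulf_neq0.
have vA : bil A v v = 0 by rewrite isoA !mxE /=; ring.
have AB x : bil A x x = 0 -> bil B x x = 0.
  move=> xA; apply: (mulfI a0); rewrite mulr0 isoB -[RHS](mulr0 a') -xA isoA.
  rewrite cE cE'; apply/eqP; rewrite -subr_eq0; apply/eqP.
  transitivity (2 * (a * b' - a' * b) * (x 0 o0 * x 0 o2 - x 0 o1 * x 0 o2)).
    by ring.
  by rewrite ab subrr; ring.
have iso x : bil A x x = 0 -> isotropic A B x by move=> xA; split=> //; exact: AB.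
pose p k := [:: vec3 1 0 0; vec3 0 1 0; vec3 0 0 1; const_mx 1; v]`_k.
have pP k : (k < 5)%N -> p k != 0 /\ isotropic A B (p k).
  have neq0 (x : 'rV[K]_3) i : x 0 i != 0 -> x != 0.
    by apply: contra_neq => ->; rewrite mxE.
  case: k => [|[|[|[|[|//]]]]] _; split.
  - by apply: (neq0 _ o0); rewrite mxE oner_eq0.
  - by apply: iso; rewrite isoA !mxE /=; ring.
  - by apply: (neq0 _ o1); rewrite mxE oner_eq0.
  - by apply: iso; rewrite isoA !mxE /=; ring.
  - by apply: (neq0 _ o2); rewrite mxE oner_eq0.
  - by apply: iso; rewrite isoA !mxE /=; ring.
  - by apply: (neq0 _ o0); rewrite mxE oner_eq0.
  - by [].
  - exact: neq0 vn0.
  - exact: iso.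
have pinj k l d : (k < 5)%N -> (l < 5)%N -> (k < l)%N -> p k != d *: p l.
  have neq (x z : 'rV[K]_3) i : x 0 i != z 0 i -> x != z by apply: contra_neq => ->.
  have neq2 (x z : 'rV[K]_3) i : x 0 i = 0 -> x != 0 -> z 0 i != 0 -> x != d *: z.
    move=> xi x0 zi; apply/eqP => xz; move/eqP: xi; rewrite xz mxE mulf_eq0 (negbTE zi).
    by rewrite orbF => /eqP d0; move: x0; rewrite xz d0 scale0r eqxx.
  move=> k5 l5 kl; have [pk _] := pP k k5.
  case: k k5 pk kl => [|[|[|[|[|//]]]]] _ pk kl.
  - by case: l l5 kl => [|[|[|[|[|//]]]]] _ // _;
      [apply: (neq2 _ _ o1)|apply: (neq2 _ _ o2)|apply: (neq2 _ _ o1)|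
       apply: (neq2 _ _ o1)]; rewrite // ?mxE ?oner_eq0 // -/v.
  - by case: l l5 kl => [|[|[|[|[|//]]]]] _ // _;
      [apply: (neq2 _ _ o2)|apply: (neq2 _ _ o0)|
       apply: (neq2 _ _ o0)]; rewrite // ?mxE ?oner_eq0 // -/v.
  - by case: l l5 kl => [|[|[|[|[|//]]]]] _ // _;
      [apply: (neq2 _ _ o0)|apply: (neq2 _ _ o0)]; rewrite // ?mxE ?oner_eq0 // -/v.
  - case: l l5 kl => [|[|[|[|[|//]]]]] _ // _; rewrite /p /=.
    apply/eqP => /rowP e; have := e o1; have := e o0; rewrite !mxE /= => e0 e1.
    by move: y1; rewrite (_ : y = 1) ?eqxx // [RHS]e1 mulrCA -e0 mulr1.
  - by case: l l5 kl => [|[|[|[|[|]]]]].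
have /choice[f fP] k : exists l, (k < 5)%N -> (l < 4)%N /\ exists d, p k = d *: w l.
  have [k5|k5] := boolP (k < 5)%N; last by exists 0%N.
  have [pk pki] := pP k k5; have [l [d [l4 e]]] := wall _ pk pki.
  by exists l => _; split=> //; exists d.
(* Pigeonhole: five pairwise non-proportional common vectors would inject into four lines. *)
pose F (k : 'I_5) : 'I_4 := inord (f k).
have : injective F.
  move=> k l /(congr1 val); have [fk [d pk]] := fP k (ltn_ord k).
  have [fl' [d' pl]] := fP l (ltn_ord l); rewrite /F /= !inordK // => fkl.
  have dn : d != 0.
    by apply: contra_neq (pP k (ltn_ord k)).1 => d0; rewrite pk d0 scale0r.
  have dn' : d' != 0.
    by apply: contra_neq (pP l (ltn_ord l)).1 => d0; rewrite pl d0 scale0r.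
  have pkl : p k = (d / d') *: p l by rewrite pk pl fkl scalerA divfK.
  have plk : p l = (d' / d) *: p k by rewrite pk pl fkl scalerA divfK.
  apply: val_inj; case: (ssrnat.ltngtP k l) => // kl.
    by have := pinj _ _ (d / d') (ltn_ord k) (ltn_ord l) kl; rewrite -pkl eqxx.
  by have := pinj _ _ (d' / d) (ltn_ord l) (ltn_ord k) kl; rewrite -plk eqxx.
by move=> /leq_card; rewrite !card_ord.
Qed.

(** No three of the four points are collinear, since the conic is nondegenerate. Three of them,
    suitably scaled, therefore form a basis in which the fourth is the unit vector, and
    [zero_diagonal_pencil] applies. *)
Lemma four_lines_general C D : C^T = C -> D^T = D ->
  \det C != 0 -> \det D != 0 -> four_lines C D -> general_eq C D != 0.
Proof.
move=> Cs Ds C0 D0 fl; have [w [wi winj _]] := fl.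
have wn k : (k < 4)%N -> w k != 0 by case/wi.
have wC k : (k < 4)%N -> bil C (w k) (w k) = 0 by case/wi => _ [].
have wD k : (k < 4)%N -> bil D (w k) (w k) = 0 by case/wi => _ [].
have bn k l : (k < 4)%N -> (l < 4)%N -> k != l -> bil C (w k) (w l) != 0.
  move=> k4 l4 kl; apply: bil_isotropic_neq0; rewrite ?wC ?wn // => a.
  by apply/eqP => /(winj _ _ _ k4 l4)/eqP; rewrite (negbTE kl).
pose V : 'M[K]_3 := \matrix_(i < 3) w i.
have rV i : row i V = w i by rewrite rowK.
have V0 : \det V != 0.
  (* The Gram matrix of three isotropic vectors has zero diagonal, so its determinant is twice the
     product of the pairings, all nonzero by [bn]. *)
  have : \det (V *m C *m V^T) != 0.
    rewrite det3 /mixdet !gram_entry !rV !wC //=.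
    rewrite (bilC (w 1%N) (w 0%N) Cs) (bilC (w 2%N) (w 0%N) Cs) (bilC (w 2%N) (w 1%N) Cs).
    have -> (p q r : K) : 0 * (0 * 0 - r * r) - p * (p * 0 - r * q) + q * (p * r - 0 * q) =
      2 * p * q * r by ring.
    by rewrite !mulf_neq0 ?pnatr_eq0 ?bn.
  by rewrite !det_mulmx !mulf_eq0 !negb_or => /andP[/andP[]].
have Vu : V \in unitmx by rewrite unitmxE unitfE.
pose y := w 3%N *m invmx V.
have w3 : w 3%N = y 0 o0 *: w 0%N + y 0 o1 *: w 1%N + y 0 o2 *: w 2%N.
  by rewrite -[LHS](mulmxKV Vu) -/y [y in LHS]vec3E mulmx_vec3 !rV.
(* Isotropy of such a combination reads [2 a b bil C (w i) (w j) = 0], so the fourth vector would be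
   a multiple of one of the others. *)
have wcomb i j (a b : K) : (i < 3)%N -> (j < 3)%N -> i != j ->
    w 3%N = a *: w i + b *: w j -> False.
  move=> i3 j3 ij e; have i4 := ltnW i3; have j4 := ltnW j3.
  have := wC 3%N isT; rewrite e !bilDl !bilDr !bilZl !bilZr !wC //.
  rewrite (bilC (w j) _ Cs) => /eqP.
  have -> : a * (a * 0) + a * (b * bil C (w i) (w j)) +
    (b * (a * bil C (w i) (w j)) + b * (b * 0)) = 2 * a * b * bil C (w i) (w j) by ring.
  rewrite !mulf_eq0 pnatr_eq0 (negbTE (bn _ _ _ _ ij)) //= orbF => /orP[]/eqP z.
    move: e; rewrite z scale0r add0r => /(winj 3%N j b isT j4) j3'.
    by rewrite -j3' in j3.
  move: e; rewrite z scale0r addr0 => /(winj 3%N i a isT i4) i3'.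
  by rewrite -i3' in i3.
have y0 : y 0 o0 != 0.
  apply/eqP => z; apply: (wcomb 1%N 2%N (y 0 o1) (y 0 o2)) => //.
  by rewrite w3 z scale0r add0r.
have y1 : y 0 o1 != 0.
  apply/eqP => z; apply: (wcomb 0%N 2%N (y 0 o0) (y 0 o2)) => //.
  by rewrite w3 z scale0r addr0.
have y2 : y 0 o2 != 0.
  apply/eqP => z; apply: (wcomb 0%N 1%N (y 0 o0) (y 0 o1)) => //.
  by rewrite w3 z scale0r addr0.
pose g : 'M[K]_3 := diag_mx y *m V.
have g0 : \det g != 0.
  rewrite det_mulmx mulf_neq0 // det_diag; apply/prodf_neq0 => i _.
  by case: (ord3P i) => ->.
have gu : g \in unitmx by rewrite unitmxE unitfE.
have rg i : row i g = y 0 i *: w i.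
  by rewrite /g row_mul row_diag_mx -scalemxAl -rowE rV.
clearbody g.
suff : general_eq (g *m C *m g^T) (g *m D *m g^T) != 0.
  by rewrite general_congr mulf_eq0 negb_or => /andP[].
have [e30 _ _ e03] := s_congr g C D.
have i4 (i : 'I_3) : (i < 4)%N := ltnW (ltn_ord i).
apply: zero_diagonal_pencil; rewrite ?congr_sym //.
- by move=> i; rewrite gram_entry rg bilZl bilZr wC // !mulr0.
- by move=> i; rewrite gram_entry rg bilZl bilZr wD // !mulr0.
- have e1 : const_mx 1 *m g = w 3%N.
    have c1 i : (const_mx 1 : 'rV[K]_3) 0 i = 1 by rewrite mxE.
    by rewrite [const_mx 1]vec3E mulmx_vec3 !rg !c1 !scale1r w3.
  by rewrite /isotropic !bil_congr e1 wC ?wD.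
- by rewrite e30 mulf_neq0 ?expf_neq0 // /s30 -det3.
- by rewrite e03 mulf_neq0 ?expf_neq0 // /s03 -det3.
- have gVu : invmx g \in unitmx by rewrite unitmx_inv.
  apply: (four_lines_congr gVu).
  suff E (A : 'M[K]_3) : invmx g *m (g *m A *m g^T) *m (invmx g)^T = A by rewrite !E.
  by rewrite !mulmxA mulVmx // mul1mx -mulmxA -trmx_mul mulVmx // trmx1 mulmx1.
Qed.

End Converse.

(** * Transversality as an open condition *)

Section Transverse.
Variable K : numClosedFieldType.

Lemma sym_mxE (v : 'rV[K]_6) : sym_mx v = sym_of v.
Proof. by []. Qed.

Lemma transverseE (p : bipspace K 5 5) :
  transverse p <-> general_eq (conic_mx p.1) (conic_mx p.2) != 0.
Proof.
have sC := sym_of_tr (hcoord p.1); have sD := sym_of_tr (hcoord p.2).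
rewrite -!sym_mxE -/(conic_mx _) in sC sD.
have SE : [set x | on_conic p.1 x /\ on_conic p.2 x] =
    [set x | isotropic (conic_mx p.1) (conic_mx p.2) (hcoord x)].
  have E C (x : pspace K 2) : on_conic C x <-> bil (conic_mx C) (hcoord x) (hcoord x) = 0.
    rewrite /on_conic /bil; split=> [->|e]; first by rewrite mxE.
    by apply/matrixP => i j; rewrite !ord1 [RHS]mxE.
  by apply/seteqP; split=> x [/E H1 /E H2].
split=> [[nC nD]|H].
  by rewrite SE => /four_linesP; exact: four_lines_general.
split; rewrite /Defs.nondegenerate ?SE.
- by move: H; rewrite det3 /general_eq !mulf_eq0 !negb_or => /andP[/andP[]].
- by move: H; rewrite det3 /general_eq !mulf_eq0 !negb_or => /andP[/andP[]].
- by apply/four_linesP; exact: general_four_lines.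
Qed.

Lemma transverse_zero_locus : transverse =
  ~` zero_locus [set general_eq (genl K) (genr K)].
Proof.
apply/seteqP; split=> p; rewrite /setC /=.
  by move=> /transverseE H /zero_locus1 /eqP; rewrite hcoordsE meval_general_eq (negbTE H).
move=> H; apply/transverseE/eqP => e; apply: H; apply/zero_locus1.
by rewrite hcoordsE meval_general_eq.
Qed.

Lemma open_transverse : open (transverse (K := K)).
Proof.
rewrite transverse_zero_locus openC; apply: closed_zero_locus1; exact: bihom_general_eq.
Qed.

End Transverse.

(** * Comparing Taylor coefficients of a square root *)

Section PowerSeries.
Variable K : numClosedFieldType.
Implicit Types (A : nat -> K) (f : K -> K).

Lemma eq0_small (q B r : K) : 0 < r -> 0 <= B ->
  (forall t, 0 < t -> t <= r -> `|q| <= B * t) -> q = 0.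
Proof.
move=> r0 B0 H; apply/eqP/negPn/negP => q0.
have q0' : 0 < `|q| by rewrite normr_gt0.
have rB0 : 0 <= r * B by rewrite mulr_ge0 // ltW.
have d0 : 0 < `|q| + r * B by rewrite ltr_wpDr.
(* This value of [t] is at most [r], and there [B * t] is smaller than the norm of [q]. *)
have t0 : 0 < r * `|q| / (`|q| + r * B) by rewrite divr_gt0 // mulr_gt0.
have : r * `|q| / (`|q| + r * B) <= r.
  by rewrite ler_pdivrMr // ler_pM2l // lerDl.
move=> /(H _ t0); rewrite mulrA ler_pdivlMr // lt_geF //.
rewrite mulrA (mulrC B) [ltLHS]mulrC ltr_pM2l //.
by rewrite ltrDr.
Qed.

Lemma quadratic_small (q0 q1 q2 B r : K) : 0 < r -> r <= 1 -> 0 <= B ->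
  (forall t, 0 < t -> t <= r -> `|q0 + q1 * t + q2 * t ^+ 2| <= B * t ^+ 3) ->
  [/\ q0 = 0, q1 = 0 & q2 = 0].
Proof.
move=> r0 r1 B0 H.
have step (q : K) (g : K -> K) (B' : K) : 0 <= B' ->
    (forall t, 0 < t -> t <= r -> `|g t| <= B') ->
    (forall t, 0 < t -> t <= r -> `|q + t * g t| <= B * t) -> q = 0.
  move=> B'0 gB qB; apply: (@eq0_small _ (B + B') r) => //; first exact: addr_ge0.
  move=> t t0 tr; rewrite -[q](addrK (t * g t)) (le_trans (ler_normB _ _)) //.
  rewrite mulrDl lerD ?qB // normrM (gtr0_norm t0) [leLHS]mulrC.
  by rewrite ler_pM2r ?gB.
have t1 t : t <= r -> t <= 1 by move=> tr; exact: le_trans r1.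
have tX t k : 0 < t -> t <= r -> B * t ^+ k.+1 <= B * t.
  move=> t0 tr; apply: ler_wpM2l => //.
  by rewrite exprS ler_piMr ?(ltW t0) // exprn_ile1 ?(ltW t0) ?t1.
have q00 : q0 = 0.
  apply: (@step _ (fun t => q1 + q2 * t) (`|q1| + `|q2|)); first exact: addr_ge0.
    move=> t t0 tr; rewrite (le_trans (ler_normD _ _)) // lerD2l normrM.
    by rewrite ler_piMr // (gtr0_norm t0) t1.
  move=> t t0 tr; have -> : q0 + t * (q1 + q2 * t) = q0 + q1 * t + q2 * t ^+ 2 by ring.
  by rewrite (le_trans (H t t0 tr)) // tX.
have q10 : q1 = 0.
  apply: (@step _ (fun _ => q2) `|q2|) => // t t0 tr.
  rewrite -(ler_pM2r t0) -[X in _ * X <= _](gtr0_norm t0) -normrM.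
  have -> : (q1 + t * q2) * t = q0 + q1 * t + q2 * t ^+ 2 by rewrite q00; ring.
  rewrite (le_trans (H t t0 tr)) // exprSr mulrA ler_pM2r // tX //.
split=> //; apply: (@eq0_small _ B r) => // t t0 tr.
rewrite -(ler_pM2r (exprn_gt0 2 t0)) -[X in _ * X <= _](gtr0_norm (exprn_gt0 2 t0)).
rewrite -normrM.
have -> : q2 * t ^+ 2 = q0 + q1 * t + q2 * t ^+ 2 by rewrite q00 q10; ring.
by rewrite (le_trans (H t t0 tr)) // -mulrA -exprS.
Qed.

Lemma geometric_tail (x : K) m N : 0 <= x -> x <= 2^-1 ->
  \sum_(m <= n < N) x ^+ n <= 2 * x ^+ m.
Proof.
move=> x0 x2; have [Nm|Nm] := leqP N m.
  by rewrite big_geq // mulr_ge0 // exprn_ge0.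
have key k : x ^+ k + 2 * x ^+ k.+1 <= 2 * x ^+ k.
  rewrite -subr_ge0 (_ : _ - _ = x ^+ k * (1 - 2 * x)); last by rewrite exprS; ring.
  by rewrite mulr_ge0 ?exprn_ge0 // subr_ge0 mulrC -ler_pdivlMr // mul1r.
(* Adding the bound [2 * x ^+ N] on the remaining tail makes the induction go through. *)
suff : \sum_(m <= n < N) x ^+ n + 2 * x ^+ N <= 2 * x ^+ m.
  by apply: le_trans; rewrite lerDl mulr_ge0 // exprn_ge0.
elim: N Nm => // N IH Nm; have [Nm'|Nm'] := leqP N m.
  have -> : N = m by apply/eqP; rewrite eqn_leq Nm' -ltnS.
  by rewrite big_nat1 key.
rewrite big_nat_recr /=; last exact: ltnW.
by rewrite -addrA (le_trans _ (IH Nm')) // lerD2l key.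
Qed.

(** Convergence at one point [t0] bounds the terms of the series there; for [t] at most [t0 / 2] the
    tail from degree three is then dominated by a geometric series. Positive [t] suffice to identify
    coefficients. *)
Lemma taylor_remainder f A : taylor_at0 f A ->
  exists r B : K, [/\ 0 < r, r <= 1, 0 <= B &
    forall t, 0 < t -> t <= r ->
      `|f t - (A 0%N + A 1%N * t + A 2%N * t ^+ 2)| <= B * t ^+ 3].
Proof.
move=> /nbhs_norm0P[e /= e0 He].
have c0 : 0 < e / (1 + e) by rewrite divr_gt0 // addr_gt0.
(* This is smaller than both [e] and [1]. *)
pose t0 := e / (1 + e).
have t0e : `|t0| < e.
  by rewrite gtr0_norm // ltr_pdivrMr ?addr_gt0 // mulrDr mulr1 ltrDl mulr_gt0.
have t01 : t0 <= 1 by rewrite ler_pdivrMr ?addr_gt0 // mul1r lerDr.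
have t00 : 0 < t0 by [].
(* From rank [N] on, consecutive partial sums are both within [1] of the limit, so each term is at
   most [2]; finitely many terms remain. *)
have [M M0 AM] : exists2 M : K, 0 <= M & forall n, `|A n| * t0 ^+ n <= M.
  move: (He t0 t0e) => /= /cvgrPdist_lt/(_ 1 ltr01)[N _ HN].
  pose u n := `|A n| * t0 ^+ n.
  have u0 n : 0 <= u n by rewrite mulr_ge0 // exprn_ge0 // ltW.
  exists (2 + \sum_(n < N) u n); first by rewrite addr_ge0 // sumr_ge0.
  move=> n; rewrite -/(u n); have [nN|Nn] := ltnP n N.
    rewrite (bigD1 (Ordinal nN)) //= addrCA lerDl addr_ge0 // sumr_ge0 //.
  rewrite -[leLHS]addr0 lerD //; last by rewrite sumr_ge0.
  have h1 := HN n Nn; have h2 := HN n.+1 (leqW Nn).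
  rewrite /= /series /= in h1 h2; rewrite big_nat_recr //= in h2.
  set s := \sum_(0 <= k < n) _ in h1 h2; set l := f t0 in h1 h2.
  have -> : u n = `|A n * t0 ^+ n| by rewrite /u normrM normrX (gtr0_norm t00).
  have -> : A n * t0 ^+ n = (l - s) - (l - (s + A n * t0 ^+ n)) by ring.
  by rewrite (le_trans (ler_normB _ _)) // -[2]/(1 + 1) lerD // ltW.
pose r := t0 / 2.
have r0 : 0 < r by rewrite divr_gt0.
exists r, (1 + M * 2 / t0 ^+ 3); split=> //.
- by rewrite (le_trans _ t01) // ler_pdivrMr // ler_peMr ?ler1n // ltW.
- by rewrite addr_ge0 // mulr_ge0 ?mulr_ge0 // invr_ge0 exprn_ge0 // ltW.
move=> t tp tr.
have te : `|t| < e.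
  rewrite gtr0_norm // (le_lt_trans tr) // (le_lt_trans _ t0e) // gtr0_norm //.
  by rewrite ler_pdivrMr // ler_peMr ?ler1n // ltW.
have t3 : 0 < t ^+ 3 by rewrite exprn_gt0.
move: (He t te) => /= /cvgrPdist_lt/(_ _ t3)[N _ HN].
have := HN (N + 3)%N (leq_addr _ _); rewrite /= /series /=.
set S := \sum_(0 <= k < N + 3) _ => fS.
have SE : S = A 0%N + A 1%N * t + A 2%N * t ^+ 2 +
    \sum_(3 <= k < N + 3) A k * t ^+ k.
  rewrite /S (big_cat_nat (n := 3%N)) //=; last by rewrite addnC.
  by congr (_ + _); rewrite !big_nat_recr //= big_geq // add0r mulr1 expr1.
have tail : `|\sum_(3 <= k < N + 3) A k * t ^+ k| <= M * (2 * (t / t0) ^+ 3).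
  apply: le_trans (ler_norm_sum _ _ _) _.
  have x0 : 0 <= t / t0 by rewrite divr_ge0 // ltW.
  have x2 : t / t0 <= 2^-1 by rewrite ler_pdivrMr // mulrC.
  apply: le_trans (ler_wpM2l M0 (geometric_tail 3 (N + 3) x0 x2)).
  rewrite mulr_sumr; apply: ler_sum => k _.
  have -> : `|A k * t ^+ k| = `|A k| * t0 ^+ k * (t / t0) ^+ k.
    rewrite normrM normrX (gtr0_norm tp) -mulrA -exprMn [t0 * _]mulrC divfK //.
    exact: lt0r_neq0.
  by apply: ler_wpM2r (AM k); exact: exprn_ge0.
have -> : f t - (A 0%N + A 1%N * t + A 2%N * t ^+ 2) =
    (f t - S) + \sum_(3 <= k < N + 3) A k * t ^+ k by rewrite SE; ring.
rewrite (le_trans (ler_normD _ _)) // mulrDl mul1r lerD ?(ltW fS) //.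
rewrite (le_trans tail) // le_eqVlt; apply/orP; left; apply/eqP.
by field; rewrite lt0r_neq0.
Qed.

(** The polynomial and the square of the quadratic Taylor polynomial differ by [O(t^3)], so their
    coefficients up to degree two agree by [quadratic_small]. *)
Lemma taylor_square f A (p : {poly K}) : size p = 4%N -> taylor_at0 f A ->
  (\forall t \near (0 : K), f t ^+ 2 = p.[t]) ->
  [/\ p`_0 = A 0%N ^+ 2, p`_1 = 2 * A 0%N * A 1%N &
      p`_2 = 2 * A 0%N * A 2%N + A 1%N ^+ 2].
Proof.
move=> p4 /taylor_remainder[r [B [r0 r1 B0 fB]]] /nbhs_norm0P[e /= e0 He].
set a := A 0%N; set b := A 1%N; set c := A 2%N.
pose q3 := p`_3 - 2 * b * c; pose q4 := - c ^+ 2.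
pose r' := r * e / (1 + e).
have e1 : 0 < 1 + e by rewrite addr_gt0.
have r'0 : 0 < r' by rewrite divr_gt0 // mulr_gt0.
have r'r : r' <= r by rewrite ler_pdivrMr // ler_pM2l // lerDr.
have r'e : r' < e.
  rewrite ltr_pdivrMr // mulrDr mulr1 (le_lt_trans (y := e)) //.
    by rewrite ler_piMl // ltW.
  by rewrite ltrDl mulr_gt0.
pose B' := B * (B + 2 * (`|a| + `|b| + `|c|)) + `|q3| + `|q4|.
have [] := @quadratic_small (p`_0 - a ^+ 2) (p`_1 - 2 * a * b)
  (p`_2 - (2 * a * c + b ^+ 2)) B' r' => //.
- exact: le_trans r1.
- by rewrite !addr_ge0 // mulr_ge0 // !addr_ge0 // mulr_ge0 // !addr_ge0.
- move=> t t0 tr'; have tr := le_trans tr' r'r.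
  have t1 : t <= 1 := le_trans tr r1.
  have /He /= ft : `|t| < e by rewrite gtr0_norm // (le_lt_trans tr').
  have pt : p.[t] = p`_0 + p`_1 * t + p`_2 * t ^+ 2 + p`_3 * t ^+ 3.
    by rewrite horner_coef p4 !big_ord_recr big_ord0 /= add0r mulr1 expr1.
  have := fB t t0 tr; rewrite -/a -/b -/c; set T := a + b * t + c * t ^+ 2 => fT.
  have -> : p`_0 - a ^+ 2 + (p`_1 - 2 * a * b) * t +
      (p`_2 - (2 * a * c + b ^+ 2)) * t ^+ 2 =
      (f t - T) * ((f t - T) + 2 * T) - q3 * t ^+ 3 - q4 * t ^+ 4.
    transitivity (p.[t] - T ^+ 2 - q3 * t ^+ 3 - q4 * t ^+ 4).
      by rewrite pt /T /q3 /q4; ring.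
    by rewrite -ft; ring.
  have tX k : t ^+ k <= 1 by rewrite exprn_ile1 // ltW.
  have Tn : `|T| <= `|a| + `|b| + `|c|.
    rewrite /T !(le_trans (ler_normD _ _)) // !lerD //.
      by rewrite (le_trans (ler_normD _ _)) // lerD // normrM ler_piMr // gtr0_norm.
    by rewrite normrM ler_piMr // normrX gtr0_norm.
  have t3 : 0 <= t ^+ 3 by rewrite exprn_ge0 // ltW.
  rewrite /B' [leRHS]mulrDl [X in _ <= X + _]mulrDl (le_trans (ler_normB _ _)) // lerD //; last first.
    rewrite normrM ler_wpM2l // normrX (gtr0_norm t0) exprS ler_piMl //.
  rewrite (le_trans (ler_normB _ _)) // lerD //; last first.
    by rewrite normrM normrX (gtr0_norm t0).
  rewrite normrM mulrAC; apply: ler_pM => //.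
  rewrite (le_trans (ler_normD _ _)) //; apply: lerD.
    by rewrite (le_trans fT) // ler_piMr.
  by rewrite normrM normr_nat ler_wpM2l.
- move=> /eqP; rewrite subr_eq0 => /eqP ->.
  by move=> /eqP; rewrite subr_eq0 => /eqP -> /eqP; rewrite subr_eq0 => /eqP ->.
Qed.

End PowerSeries.

(** * Convergence of the formal square root *)

Section SquareRootSeries.
Variable K : numClosedFieldType.
Implicit Types (A : nat -> K) (f : K -> K).

Lemma sum_inv_sqr n : \sum_(1 <= i < n) (i%:R ^+ 2)^-1 <= 2 :> K.
Proof.
case: n => [|n]; first by rewrite big_geq.
case: n => [|n]; first by rewrite big_geq.
suff : \sum_(1 <= i < n.+2) (i%:R ^+ 2)^-1 <= 2 - n.+1%:R^-1 :> K.
  by move=> /le_trans; apply; rewrite gerBl invr_ge0.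
elim: n => [|n IH].
  by rewrite big_nat1 expr1n invr1 (_ : 2 - 1 = 1) //; ring.
rewrite big_nat_recr //= (le_trans (lerD IH (lexx _))) //.
rewrite -subr_ge0.
have n1 : n.+1%:R != 0 :> K by rewrite pnatr_eq0.
have n2 : n.+2%:R != 0 :> K by rewrite pnatr_eq0.
rewrite (_ : _ - _ = (n.+1%:R * n.+2%:R ^+ 2)^-1).
  by rewrite invr_ge0 mulr_ge0 // exprn_ge0.
move: n1 n2; rewrite -[n.+2]addn1 natrD; move: n.+1%:R => x x0 x1.
by field; rewrite x0 x1.
Qed.

(** With [i + j = n], one has [n^2 / (i^2 j^2) = (1/i + 1/j)^2 <= 2/i^2 + 2/j^2]. The weights
    [1/n^2] are thus stable under convolution up to a factor [8], which is why they are used in the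
    majorant. *)
Lemma sum_inv_sqr_conv n : (0 < n)%N ->
  \sum_(1 <= i < n) (i%:R ^+ 2)^-1 * ((n - i)%:R ^+ 2)^-1
    <= 8 * (n%:R ^+ 2)^-1 :> K.
Proof.
move=> n0; have nn : n%:R != 0 :> K by rewrite pnatr_eq0 -lt0n.
have n2 : 0 < n%:R ^+ 2 :> K by rewrite exprn_gt0 // ltr0n.
rewrite -ler_pdivrMr ?invr_gt0 // invrK mulr_suml.
have le1 : \sum_(1 <= i < n) (i%:R ^+ 2)^-1 * ((n - i)%:R ^+ 2)^-1 * n%:R ^+ 2
    <= \sum_(1 <= i < n) (2 * (i%:R ^+ 2)^-1 + 2 * ((n - i)%:R ^+ 2)^-1) :> K.
  rewrite big_nat_cond [leRHS]big_nat_cond; apply: ler_sum => i.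
  rewrite andbT => /andP[i1 i_n].
  have inz : i%:R != 0 :> K by rewrite pnatr_eq0 -lt0n.
  have jnz : (n - i)%:R != 0 :> K by rewrite pnatr_eq0 subn_eq0 -ltnNge.
  have nE : n%:R = i%:R + (n - i)%:R :> K by rewrite -natrD subnKC // ltnW.
  rewrite nE -subr_ge0.
  rewrite (_ : _ - _ = (i%:R^-1 - (n - i)%:R^-1) ^+ 2); last by field; rewrite inz jnz.
  by rewrite real_exprn_even_ge0 // rpredB // rpredV realn.
apply: le_trans le1 _; rewrite big_split /= -!mulr_sumr.
have -> : \sum_(1 <= i < n) ((n - i)%:R ^+ 2)^-1 = \sum_(1 <= i < n) (i%:R ^+ 2)^-1 :> K.
  rewrite big_nat_rev /= big_nat_cond [RHS]big_nat_cond.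
  by apply: eq_bigr => i /andP[/andP[i1 i_n] _]; congr ((_ %:R ^+ 2)^-1); lia.
rewrite -mulrDl (_ : 8 = (2 + 2) * 2); last by ring.
by rewrite ler_wpM2l // ?sum_inv_sqr // -natrD.
Qed.

Variables (p : {poly K}) (a : K).
Hypotheses (a0 : a != 0) (p0 : p`_0 = a ^+ 2) (p4 : (size p <= 4)%N).

(** The square root of [p] with constant term [a], truncated at degree [n]: dividing the next
    coefficient of the error by [2 * a] corrects it. *)
Fixpoint sqrt_trunc n : {poly K} :=
  if n is m.+1 then
    sqrt_trunc m + ((p - sqrt_trunc m ^+ 2)`_n / (2 * a)) *: 'X^n
  else a%:P.

Definition sqrt_coef n := (sqrt_trunc n)`_n.

Local Notation S := sqrt_trunc.
Local Notation A := sqrt_coef.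

Lemma size_sqrt_trunc n : (size (S n) <= n.+1)%N.
Proof.
elim: n => [|n IH]; first by rewrite size_polyC leq_b1.
rewrite (leq_trans (size_polyD _ _)) // geq_max (leq_trans IH) //=.
by rewrite (leq_trans (size_scale_leq _ _)) // size_polyXn.
Qed.

Lemma coef_sqrt_trunc n k : (k <= n)%N -> (S n)`_k = A k.
Proof.
elim: n => [|n IH]; first by rewrite leqn0 => /eqP ->.
rewrite leq_eqVlt => /orP[/eqP -> //|kn].
by rewrite /= coefD coefZ coefXn (ltn_eqF kn) mulr0 addr0 IH.
Qed.

Lemma coef_sqrt_trunc0 n k : (n < k)%N -> (S n)`_k = 0.
Proof.
by move=> nk; apply: nth_default; exact: leq_trans (size_sqrt_trunc n) nk.
Qed.

Lemma sqrt_coef0 : A 0%N = a. Proof. by rewrite /sqrt_coef coefC. Qed.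

Lemma sqrt_coefS n : A n.+1 = (p - S n ^+ 2)`_n.+1 / (2 * a).
Proof.
by rewrite /sqrt_coef /= coefD coefZ coefXn eqxx mulr1 coef_sqrt_trunc0 // add0r.
Qed.

Lemma sqrt_trunc_sqr n k : (k <= n)%N -> (p - S n ^+ 2)`_k = 0.
Proof.
elim: n k => [|n IH] k.
  rewrite leqn0 => /eqP ->; rewrite coefB expr2 coef0M coefC /= p0; ring.
move=> kn; pose c := (p - S n ^+ 2)`_n.+1 / (2 * a).
have -> : p - S n.+1 ^+ 2 = p - S n ^+ 2 - (2 * c) *: (S n * 'X^(n.+1))
    - c ^+ 2 *: ('X^(n.+1) * 'X^(n.+1)).
  by rewrite /= -/c -!mul_polyC; ring.
rewrite coefB [X in X - _]coefB !coefZ !coefMXn coefXn.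
move: kn; rewrite leq_eqVlt => /orP[/eqP ->|kn].
  rewrite ltnn subnn coef_sqrt_trunc // sqrt_coef0 /= mulr0 subr0 /c.
  by field.
rewrite kn IH //; ring.
Qed.

Lemma sqrt_trunc_horner n t : (S n).[t] = series (fun k => A k * t ^+ k) n.+1.
Proof.
rewrite (horner_coef_wide _ (size_sqrt_trunc n)) /series /= big_mkord.
by apply: eq_bigr => k _; rewrite coef_sqrt_trunc // -ltnS.
Qed.

(** Constants of the majorant [kappa rho^n / n^2]. The [8] matches the factor of [sum_inv_sqr_conv];
    the [9] is the largest [n^2] among the degrees [n <= 3] at which [p] may have a coefficient. *)
Let kappa := `|a| / 8.
Let rho := 1 + 9 * (`|p`_1| + `|p`_2| + `|p`_3|) / (`|a| * kappa).

Let na : 0 < `|a|. Proof. by rewrite normr_gt0. Qed.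
Let kappa0 : 0 < kappa. Proof. by rewrite /kappa divr_gt0. Qed.
Let rho1 : 1 <= rho.
Proof.
by rewrite /rho lerDl divr_ge0 // mulr_ge0 ?addr_ge0 // ltW.
Qed.
Let rho0 : 0 < rho. Proof. exact: lt_le_trans rho1. Qed.

Lemma coef_bound n : (0 < n)%N ->
  `|p`_n| <= `|a| * (kappa * rho ^+ n * (n%:R ^+ 2)^-1).
Proof.
move=> n0; have nn : 0 < n%:R ^+ 2 :> K by rewrite exprn_gt0 // ltr0n.
have [n4|n4] := leqP 4 n.
  rewrite nth_default ?normr0; last exact: leq_trans p4 n4.
  by rewrite !mulr_ge0 ?invr_ge0 ?exprn_ge0 // ltW.
rewrite (_ : `|a| * _ = `|a| * kappa * rho ^+ n / n%:R ^+ 2); last by ring.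
rewrite ler_pdivlMr //.
apply: (@le_trans _ _ (`|p`_n| * 9)).
  rewrite ler_wpM2l // (_ : 9 = 3 ^+ 2 :> K); last by ring.
  by rewrite ler_pXn2r ?nnegrE // ler_nat -ltnS.
have ak : 0 < `|a| * kappa by rewrite mulr_gt0.
rewrite -ler_pdivrMl //.
apply: (@le_trans _ _ rho); last first.
  by case: n n0 {nn n4} => // n _; rewrite exprS ler_peMr ?exprn_ege1 // ltW.
rewrite [leLHS]mulrC /rho -[leLHS]add0r lerD // ler_pM2r ?invr_gt0 //.
rewrite [leLHS]mulrC ler_wpM2l //.
case: n n0 n4 {nn} => [|[|[|[|]]]] // _ _.
- by rewrite -addrA lerDl addr_ge0.
- by rewrite addrAC lerDr addr_ge0.
- by rewrite lerDr addr_ge0.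
Qed.

Lemma sqrt_coef_rec n : 2 * a * A n.+1 =
  p`_n.+1 - \sum_(1 <= i < n.+1) A i * A (n.+1 - i)%N.
Proof.
rewrite sqrt_coefS mulrC divfK; last by rewrite mulf_neq0 // pnatr_eq0.
rewrite coefB expr2 coefM; congr (_ - _).
rewrite -(big_mkord xpredT (fun i => (S n)`_i * (S n)`_(n.+1 - i)%N)).
rewrite big_nat_recr //= big_nat_recl //= subn0 (coef_sqrt_trunc0 (ltnSn n)).
rewrite mulr0 add0r mul0r addr0 [RHS]big_add1 /= big_nat_cond [RHS]big_nat_cond.
apply: eq_bigr => i /andP[/andP[_ i_n] _].
by rewrite !coef_sqrt_trunc //; lia.
Qed.

(** Strong induction on [sqrt_coef_rec]: relative to the claimed bound, the coefficient of [p] costs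
    a factor of the norm of [a] and the convolution a factor [8 * kappa], which is the same number;
    their sum matches the factor on the left. *)
Lemma sqrt_coef_bound n : (0 < n)%N ->
  `|A n| <= kappa * rho ^+ n * (n%:R ^+ 2)^-1.
Proof.
elim/ltn_ind: n => [[|n] // IH _].
have a2 : 0 < 2 * `|a| by rewrite mulr_gt0.
rewrite -(ler_pM2l a2) (_ : 2 * `|a| * `|A n.+1| = `|2 * a * A n.+1|); last first.
  by rewrite !normrM normr_nat.
rewrite sqrt_coef_rec (le_trans (ler_normB _ _)) //.
set b := kappa * rho ^+ n.+1 * _.
rewrite (_ : 2 * `|a| * b = `|a| * b + 8 * kappa * b); last first.
  by rewrite /kappa; field.
apply: lerD; first exact: coef_bound.
apply: le_trans (ler_norm_sum _ _ _) _.
apply: (@le_trans _ _ (\sum_(1 <= i < n.+1)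
   (kappa ^+ 2 * rho ^+ n.+1) * ((i%:R ^+ 2)^-1 * ((n.+1 - i)%:R ^+ 2)^-1))).
  rewrite big_nat_cond [leRHS]big_nat_cond; apply: ler_sum => i.
  rewrite andbT => /andP[i1 i_n]; rewrite normrM.
  rewrite (_ : kappa ^+ 2 * rho ^+ n.+1 * _ =
     (kappa * rho ^+ i * (i%:R ^+ 2)^-1) *
     (kappa * rho ^+ (n.+1 - i) * ((n.+1 - i)%:R ^+ 2)^-1)).
    by apply: ler_pM => //; apply: IH; lia.
  by rewrite -{1}(subnKC (ltnW i_n)) exprD; ring.
rewrite -mulr_sumr.
have k2 : 0 <= kappa ^+ 2 * rho ^+ n.+1 by rewrite mulr_ge0 // exprn_ge0 // ltW.
apply: le_trans (ler_wpM2l k2 (sum_inv_sqr_conv (ltn0Sn n))) _.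
by rewrite /b le_eqVlt; apply/orP; left; apply/eqP; ring.
Qed.

Lemma sqrt_trunc_dist n t : rho * `|t| <= 2^-1 -> `|(S n).[t] - a| <= `|a| / 2.
Proof.
move=> rt; rewrite sqrt_trunc_horner /series /= big_nat_recl //= sqrt_coef0 mulr1.
rewrite addrC addKr; apply: le_trans (ler_norm_sum _ _ _) _.
have x0 : 0 <= rho * `|t| by rewrite mulr_ge0 // ltW.
apply: (@le_trans _ _ (kappa * \sum_(1 <= k < n.+1) (rho * `|t|) ^+ k)).
  rewrite mulr_sumr big_add1 /=; apply: ler_sum => k _.
  rewrite normrM normrX exprMn mulrA ler_wpM2r ?exprn_ge0 //.
  apply: le_trans (sqrt_coef_bound (ltn0Sn k)) _.
  apply: ler_piMr; first by rewrite mulr_ge0 ?exprn_ge0 // ltW.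
  by rewrite invf_le1 ?exprn_gt0 ?ltr0n // exprn_ege1 // ler1n.
apply: le_trans (ler_wpM2l (ltW kappa0) (geometric_tail 1 n.+1 x0 rt)) _.
apply: le_trans (_ : kappa * 1 <= _).
  by rewrite ler_pM2l // expr1 mulrC -ler_pdivlMr // mul1r.
by rewrite mulr1 /kappa ler_pM2l // lef_pV2 ?posrE // ler_nat.
Qed.

Lemma sqrt_coef_le n : `|A n| <= `|a| * rho ^+ n.
Proof.
case: n => [|n]; first by rewrite sqrt_coef0 mulr1.
apply: le_trans (sqrt_coef_bound (ltn0Sn n)) _.
rewrite mulrAC ler_wpM2r ?exprn_ge0 ?(ltW rho0) //.
have n1 : (n.+1%:R ^+ 2)^-1 <= 1 :> K.
  by rewrite invf_le1 ?exprn_gt0 ?ltr0n // exprn_ege1 // ler1n.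
rewrite (le_trans (ler_wpM2l (ltW kappa0) n1)) // mulr1 /kappa.
by rewrite ler_pdivrMr // ler_peMr // ler1n.
Qed.

(** The difference has no coefficient up to degree [n]. A later coefficient of index [k] is a sum of
    [k + 1] products; since [k + 1 <= 2^k], the ratio [1/4] still leaves a geometric series of ratio
    [1/2]. *)
Lemma sqrt_trunc_sqr_dist n t : (3 <= n)%N -> rho * `|t| <= 4^-1 ->
  `|p.[t] - (S n).[t] ^+ 2| <= `|a| ^+ 2 * 2 * 2^-1 ^+ n.+1.
Proof.
move=> n3 rt; rewrite -horner_exp -hornerN -hornerD; set Q := p - _.
have x0 : 0 <= rho * `|t| by rewrite mulr_ge0 // ltW.
have SA j : `|(S n)`_j| <= `|a| * rho ^+ j.
  have [jn|nj] := leqP j n; first by rewrite coef_sqrt_trunc // sqrt_coef_le.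
  by rewrite coef_sqrt_trunc0 // normr0 mulr_ge0 // exprn_ge0 // ltW.
have Qk k : (n < k)%N -> `|Q`_k * t ^+ k| <= `|a| ^+ 2 * 2^-1 ^+ k.
  move=> nk; rewrite /Q coefB (nth_default _ (leq_trans p4 (leq_ltn_trans n3 nk))).
  rewrite sub0r normrM normrN expr2 coefM.
  apply: (@le_trans _ _ (\sum_(j < k.+1) `|a| ^+ 2 * rho ^+ k * `|t ^+ k|)).
    rewrite -mulr_suml ler_wpM2r //; apply: le_trans (ler_norm_sum _ _ _) _.
    apply: ler_sum => j _; rewrite normrM.
    rewrite (_ : `|a| ^+ 2 * rho ^+ k = (`|a| * rho ^+ j) * (`|a| * rho ^+ (k - j))).
      exact: ler_pM.
    by rewrite -{1}(subnKC (leq_ord j)) exprD; ring.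
  rewrite sumr_const card_ord normrX.
  rewrite (_ : _ *+ _ = `|a| ^+ 2 * ((rho * `|t|) ^+ k * k.+1%:R)); last first.
    by rewrite exprMn -mulr_natr; ring.
  rewrite ler_wpM2l ?exprn_ge0 //.
  apply: (@le_trans _ _ (4^-1 ^+ k * 2 ^+ k)).
    apply: ler_pM; rewrite ?exprn_ge0 //; first by rewrite lerXn2r ?nnegrE // invr_ge0.
    by rewrite -natrX ler_nat; exact: ltn_expl.
  rewrite -exprMn (_ : 4^-1 * 2 = 2^-1 :> K) //; by field.
rewrite (@horner_coef_wide _ (n.+1 + size Q)) ?leq_addl //.
rewrite -(big_mkord xpredT (fun k => Q`_k * t ^+ k)) (big_cat_nat (n := n.+1)) ?leq_addr //=.
rewrite big_nat_cond big1 ?add0r; last first.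
  by move=> k /andP[/andP[_ kn] _]; rewrite /Q sqrt_trunc_sqr ?mul0r // -ltnS.
apply: le_trans (ler_norm_sum _ _ _) _.
apply: (@le_trans _ _ (\sum_(n.+1 <= k < n.+1 + size Q) `|a| ^+ 2 * 2^-1 ^+ k)).
  rewrite big_nat_cond [leRHS]big_nat_cond; apply: ler_sum => k.
  by rewrite andbT => /andP[/Qk].
rewrite -mulr_sumr -mulrA ler_wpM2l ?exprn_ge0 //.
by apply: geometric_tail => //; rewrite invr_ge0.
Qed.

(* Of the two square roots of [p.[t]], the one closer to [a] is the limit, as
   the partial sums stay close to [a]. *)
Lemma sqrt_series : (forall e : K, 0 < e -> exists n, 2^-1 ^+ n < e) ->
  exists2 f, taylor_at0 f A & \forall t \near (0 : K), f t ^+ 2 = p.[t].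
Proof.
move=> arch.
have /choice[f fP] (t : K) : exists z, z ^+ 2 = p.[t] /\ `|z - a| <= `|z + a|.
  have sE := sqrtCK p.[t]; set s := sqrtC _ in sE.
  have [h|h] := real_leP (normr_real (s - a)) (normr_real (s + a)).
    by exists s.
  exists (- s); rewrite sqrrN; split=> //.
  by rewrite -opprD normrN [- s + a]addrC distrC ltW.
exists f; last by apply/nbhs_norm0P; exists 1 => //= t _; case: (fP t).
have r0 : 0 < 4^-1 / rho by rewrite divr_gt0 // invr_gt0.
near=> t.
have rt : rho * `|t| <= 4^-1.
  rewrite mulrC -ler_pdivlMr // ltW //; near: t; exact: nbhs0_lt.
have rt2 : rho * `|t| <= 2^-1.
  by rewrite (le_trans rt) // lef_pV2 ?posrE // ler_nat.
have [ft fa] := fP t.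
have fa' : `|a| <= `|f t + a|.
  have : 2 * `|a| <= 2 * `|f t + a|.
    rewrite -[2 in leLHS]normr_nat -normrM (_ : 2 * a = (f t + a) - (f t - a)); last by ring.
    by rewrite (le_trans (ler_normB _ _)) // mulr_natl mulr2n lerD2l.
  by rewrite ler_pM2l.
(* The difference of squares factors, and the factor [f t + (S n).[t]] stays away from zero, so the
   other factor is small. *)
have dist n : (3 <= n)%N -> `|f t - (S n).[t]| <= `|a| * 4 * 2^-1 ^+ n.+1.
  move=> n3; have sd := sqrt_trunc_dist n rt2.
  have ge : `|a| / 2 <= `|f t + (S n).[t]|.
    rewrite (_ : f t + _ = (f t + a) - (a - (S n).[t])); last by ring.
    rewrite (le_trans _ (lerB_dist _ _)) // distrC lerBrDl.
    by apply: le_trans fa'; rewrite [leRHS]splitr lerD2r.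
  have : `|f t - (S n).[t]| * (`|a| / 2) <= `|a| ^+ 2 * 2 * 2^-1 ^+ n.+1.
    apply: le_trans (sqrt_trunc_sqr_dist n3 rt).
    by rewrite -ft subr_sqr normrM ler_wpM2l.
  rewrite -ler_pdivlMr ?divr_gt0 // => /le_trans; apply.
  rewrite le_eqVlt; apply/orP; left; apply/eqP.
  by field; rewrite gt_eqF.
apply/cvgrPdist_lt => e e0.
have a4 : 0 < `|a| * 4 by rewrite mulr_gt0.
have [N HN] := arch (e / (`|a| * 4)) (divr_gt0 e0 a4).
exists (N + 4)%N => // -[|n] /= Nn; first by rewrite addnC in Nn.
rewrite -sqrt_trunc_horner (le_lt_trans (dist n _)) //; first by lia.
rewrite mulrC -ltr_pdivlMr // (le_lt_trans _ HN) //.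
by rewrite ler_wiXn2l ?invr_ge0 ?invf_le1 ?ler1n //; lia.
Unshelve. all: by end_near.
Qed.

End SquareRootSeries.

(** * The Cayley equation *)

Section CayleyEquation.
Variable K : numClosedFieldType.
Hypothesis arch : forall e : K, 0 < e -> exists n, 2^-1 ^+ n < e.

Lemma size_pencil (C D : 'M[K]_3) : s30 C D != 0 -> size (pencil C D) = 4%N.
Proof.
move=> a0; have [c3 _ _ _] := pencil_coef C D.
apply/eqP; rewrite eqn_leq; apply/andP; split.
  apply/leq_sizeP => j j4; rewrite pencilE !coefD !coefCM !coefXn coefX coefC.
  by case: j j4 => [|[|[|[|j]]]] //= _; rewrite !mulr0 !addr0.
by rewrite ltnNge; apply/negP => /leq_sizeP/(_ 3%N (leqnn _)) /eqP;
  rewrite c3 (negbTE a0).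
Qed.

(** The coefficient identities turn the equation into [8 A0^3 A2 = 0]. From right to left the branch
    is the one built by [sqrt_series] from a square root of the constant coefficient. *)
Lemma cayley_coef (C D : 'M[K]_3) : s30 C D != 0 -> s03 C D != 0 ->
  (exists f A, [/\ sqrt_det_branch C D f, taylor_at0 f A & A 2%N = 0]) <->
  cayley_eq C D = 0.
Proof.
move=> c0 d0; have sz := size_pencil c0.
have [c3 c2 c1 c0'] := pencil_coef C D.
rewrite /cayley_eq -c2 -c1 -c0'; split=> [[f [A [fb fA A2]]]|eq].
  have [|-> -> ->] := taylor_square sz fA; last by rewrite A2; ring.
  by apply: filterS fb => t; rewrite horner_pencil.
pose a := sqrtC (pencil C D)`_0.
have aE : (pencil C D)`_0 = a ^+ 2 by rewrite sqrtCK.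
have a0 : a != 0 by rewrite sqrtC_eq0 c0'.
have [|f fA fb] := sqrt_series a0 aE _ arch; first by rewrite sz.
exists f, (sqrt_coef (pencil C D) a); split=> //.
  by apply: filterS fb => t ->; rewrite horner_pencil.
have [_ e1 e2] := taylor_square sz fA fb.
rewrite sqrt_coef0 in e1 e2; move: eq; rewrite e1 e2 aE.
set x := sqrt_coef _ _ 2%N; set y := sqrt_coef _ _ 1%N => /eqP.
have -> : - (2 * a * y) ^+ 2 + 4 * a ^+ 2 * (2 * a * x + y ^+ 2) =
  8 * a ^+ 3 * x by ring.
by rewrite !mulf_eq0 pnatr_eq0 !(negbTE a0) /= => /eqP.
Qed.

Lemma cayleyE (p : bipspace K 5 5) : cayley_set p <->
  transverse p /\ cayley_eq (conic_mx p.1) (conic_mx p.2) = 0.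
Proof.
have H : transverse p ->
    s30 (conic_mx p.1) (conic_mx p.2) != 0 /\ s03 (conic_mx p.1) (conic_mx p.2) != 0.
  by move=> /transverseE; rewrite /general_eq !mulf_eq0 !negb_or => /andP[/andP[]].
split=> -[pT pC]; have [h30 h03] := H pT; split=> //.
  by apply/(cayley_coef h30 h03).
by apply/(cayley_coef h30 h03).
Qed.

Lemma cayley_eqE : cayley_set = transverse `&`
  [set p : bipspace K 5 5 | let C := conic_mx p.1 in let D := conic_mx p.2 in
    - sigma12 C D ^+ 2 + 4 * sigma03 C D * sigma21 C D = 0].
Proof.
have E (p : bipspace K 5 5) : - sigma12 (conic_mx p.1) (conic_mx p.2) ^+ 2 +
    4 * sigma03 (conic_mx p.1) (conic_mx p.2) * sigma21 (conic_mx p.1) (conic_mx p.2) =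
    cayley_eq (conic_mx p.1) (conic_mx p.2).
  have [_ e2 e1 e0] := pencil_coef (conic_mx p.1) (conic_mx p.2).
  by rewrite /cayley_eq -e0 -e1 -e2.
apply/seteqP; split=> p; first by move=> /cayleyE[pT]; rewrite /setI /= E.
by rewrite /setI /= E => ?; exact/cayleyE.
Qed.

Lemma cayley_zero_locus : cayley_set =
  transverse `&` zero_locus [set cayley_eq (genl K) (genr K)].
Proof.
apply/seteqP; split=> p.
  by move=> /cayleyE[pT pC]; split=> //; apply/zero_locus1; rewrite hcoordsE meval_cayley_eq.
by move=> [pT /zero_locus1]; rewrite hcoordsE meval_cayley_eq => pC; exact/cayleyE.
Qed.

End CayleyEquation.

(** A positive complex number is real, so this is the Archimedean property of [R]; it is what makes
    the partial sums in [sqrt_series] converge. *)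
Lemma complex_archimedean (R : realType) (e : R[i]) :
  0 < e -> exists n, 2^-1 ^+ n < e.
Proof.
rewrite ltcE /= => /andP[/eqP ie re].
pose n := Num.bound (complex.Re e)^-1; exists n.
have -> : e = (complex.Re e)%:C%C by case: e ie re {n} => a b /= -> _.
have -> : 2^-1 ^+ n = (2^-1 ^+ n)%:C%C :> R[i].
  by rewrite rmorphXn fmorphV rmorph_nat.
rewrite ltcR exprVn invf_plt ?posrE ?exprn_gt0 //.
by apply: upper_nthrootP; exact: leqnn.
Qed.

(** * Irreducibility by polynomial curves *)

Section PolynomialCurves.
Variable K : closedFieldType.
Variables n m : nat.
Implicit Types (Z : set (bipspace K n m)).

Definition poly_join (x : 'rV[{poly K}]_n.+1) (y : 'rV[{poly K}]_m.+1) :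
  'I_(n.+1 + m.+1) -> {poly K} := row_mx x y 0.

Definition curve_point x y t : bipspace K n m :=
  bipoint (map_mx (horner_eval t) x) (map_mx (horner_eval t) y).

Lemma horner_mmap x y (f : mpoly (n.+1 + m.+1) K) t :
  (mmap polyC (poly_join x y) f).[t] =
  meval (join (map_mx (horner_eval t) x) (map_mx (horner_eval t) y)) f.
Proof.
rewrite mevalE /mmap horner_sum; apply: eq_bigr => e _.
rewrite hornerCM; congr (_ * _); rewrite /mmap1 horner_prod.
apply: eq_bigr => i _; rewrite horner_exp; congr (_ ^+ _).
by rewrite /poly_join /join -map_row_mx [RHS]mxE.
Qed.

(** If [F] misses [p] and [G] misses [q], equations of [F] and [G] pull back to nonzero polynomials
    in [t] along a curve from [p] to [q]. A common non-root of these and [h] gives a point of [Z]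
    outside [F] and [G]. *)
Lemma curve_irreducible Z : Z !=set0 ->
  (forall p q, Z p -> Z q -> exists x y (h : {poly K}),
    [/\ p = curve_point x y 0, q = curve_point x y 1, ~~ root h 0, ~~ root h 1 &
        forall t, ~~ root h t -> [/\ map_mx (horner_eval t) x != 0,
          map_mx (horner_eval t) y != 0 & Z (curve_point x y t)]]) ->
  irreducible Z.
Proof.
move=> Z0 curve; split=> // F G Fcl Gcl ZFG; apply: contrapT => /not_orP[ZF ZG].
have [p [Zp nFp]] : exists p, Z p /\ ~ F p.
  by move/existsNP: ZF => [p /not_implyP]; exists p.
have [q [Zq nGq]] : exists q, Z q /\ ~ G q.
  by move/existsNP: ZG => [q /not_implyP]; exists q.
have [f [fh fF fp]] := closed_separate Fcl nFp.
have [g [gh gG gq]] := closed_separate Gcl nGq.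
have [x [y [h [pE qE h0 h1 hZ]]]] := curve p q Zp Zq.
have root_vanish (k : mpoly (n.+1 + m.+1) K) t : bihomogeneous k -> ~~ root h t ->
    root (mmap polyC (poly_join x y) k) t =
    (meval (hcoords (curve_point x y t)) k == 0).
  move=> kh /hZ[x0 y0 _]; rewrite /root horner_mmap.
  by rewrite /curve_point meval_bipoint.
have : mmap polyC (poly_join x y) f * mmap polyC (poly_join x y) g * h != 0.
  rewrite !mulf_neq0 //.
  - by apply: contraNneq fp => f0; rewrite pE -root_vanish // f0 root0.
  - by apply: contraNneq gq => g0; rewrite qE -root_vanish // g0 root0.
  - by apply: contraNneq h0 => ->; rewrite root0.
move=> /closed_nonrootP[t]; rewrite !rootM !negb_or => /andP[/andP[ft gt] ht].
have [_ _ /ZFG[/fF|/gG] /zero_locus1/eqP] := hZ t ht.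
  by rewrite -root_vanish // (negbTE ft).
by rewrite -root_vanish // (negbTE gt).
Qed.

End PolynomialCurves.

Lemma irreducible_closure (T : topologicalType) (Z Y : set T) :
  irreducible Z -> Z `<=` Y -> Y `<=` closure Z -> irreducible Y.
Proof.
move=> [[x Zx] Zirr] ZY Ycl; split=> [|F G Fcl Gcl YFG]; first by exists x; exact: ZY.
have [ZF|ZG] := Zirr F G Fcl Gcl (subset_trans ZY YFG); [left|right].
  by apply: subset_trans Ycl _; rewrite ((closure_id F).1 Fcl); exact: closure_subset.
by apply: subset_trans Ycl _; rewrite ((closure_id G).1 Gcl); exact: closure_subset.
Qed.

(** * A nine-parameter family of Cayley pairs *)

Section Parametrization.

Definition mat3 (R : nzRingType) (s : seq (seq R)) : 'M[R]_3 :=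
  \matrix_(i, j) (nth [::] s i)`_j.

Section Ring.
Variable R : comNzRingType.
Implicit Types u : nat -> R.

(* The conics [C] with [(C, 1)] in the Cayley set and [C 1 1 = 1]. *)
Definition fiber_mx u : 'M[R]_3 :=
  let z := u 0%N ^+ 2 + u 1%N ^+ 2 + u 2%N ^+ 2 + u 3%N ^+ 2 in
  mat3 [:: [:: 1 + z + 2 * u 0%N; u 1%N; u 2%N]; [:: u 1%N; 1; u 3%N]; [:: u 2%N; u 3%N; z]].

(** Congruence by [g] turns [(C, 1)] into [(g C g^T, g g^T)]. A triangular [g] with first diagonal
    entry [1] contributes five parameters beside the four of [fiber_mx]. *)
Definition frame_mx u : 'M[R]_3 :=
  mat3 [:: [:: 1; 0; 0]; [:: u 7%N; u 4%N; 0]; [:: u 8%N; u 6%N; u 5%N]].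

Definition param_l u := frame_mx u *m fiber_mx u *m (frame_mx u)^T.
Definition param_r u := frame_mx u *m 1%:M *m (frame_mx u)^T.

Lemma fiber_mx_sym u : (fiber_mx u)^T = fiber_mx u.
Proof.
apply/matrixP => i j; rewrite !mxE.
by case: (ord3P i) => ->; case: (ord3P j) => ->.
Qed.

Lemma fiber_mx_ext u w p q r :
  u 0%N = w -> u 1%N = p -> u 2%N = q -> u 3%N = r ->
  fiber_mx u = fiber_mx (fun j => [:: w; p; q; r]`_j).
Proof. by move=> <- <- <- <-. Qed.

Lemma det_frame_mx u : \det (frame_mx u) = u 4%N * u 5%N.
Proof. by rewrite det3 /mixdet !mxE /=; ring. Qed.

Lemma cayley_eq_fiber u : cayley_eq (fiber_mx u) 1%:M = 0.
Proof. by rewrite /cayley_eq /s12 /s03 /s21 /mixdet !mxE /=; ring. Qed.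

Lemma cayley_eq_param u : cayley_eq (param_l u) (param_r u) = 0.
Proof. by rewrite cayley_congr cayley_eq_fiber mulr0. Qed.

Lemma general_eq_param u : general_eq (param_l u) (param_r u) =
  (u 4%N * u 5%N) ^+ 12 * general_eq (fiber_mx u) 1%:M.
Proof. by rewrite general_congr det_frame_mx. Qed.

End Ring.
Arguments cayley_eq_fiber {R} u.

Lemma map_mat3 (R S : nzRingType) (f : {rmorphism R -> S}) s :
  map_mx f (mat3 s) = mat3 [seq [seq f x | x <- r] | r <- s].
Proof.
apply/matrixP => i j; rewrite !mxE.
have [si|si] := ltnP i (size s).
  rewrite (nth_map [::]) //; have [sj|sj] := ltnP j (size (nth [::] s i)).
    by rewrite (nth_map 0).
  by rewrite [RHS]nth_default ?size_map // nth_default // rmorph0.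
have -> : nth [::] [seq [seq f x | x <- r] | r <- s] i = [::].
  by rewrite nth_default ?size_map.
by rewrite [nth [::] s i]nth_default // !nth_nil rmorph0.
Qed.

Lemma map_param (R S : comNzRingType) (f : {rmorphism R -> S}) u :
  map_mx f (param_l u) = param_l (f \o u) /\ map_mx f (param_r u) = param_r (f \o u).
Proof.
have fr : map_mx f (frame_mx u) = frame_mx (f \o u).
  by rewrite map_mat3 /= !rmorph0 rmorph1.
have fi : map_mx f (fiber_mx u) = fiber_mx (f \o u).
  by rewrite map_mat3 /fiber_mx /= !(rmorphD, rmorphXn, rmorphM, rmorph1, rmorph_nat).
by rewrite !map_mxM -!map_trmx fr fi map_scalar_mx rmorph1.
Qed.

Section Family.
Variable K : numClosedFieldType.
Implicit Types u v : nat -> K.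

Definition param_point u : bipspace K 5 5 :=
  bipoint (coords_of (param_l u)) (coords_of (param_r u)).

(** These parameters give [C = diag(9, 1, 4)] and [D = 1], which is transverse since the eigenvalues
    are distinct and nonzero. *)
Definition base j : K := [:: 2; 0; 0; 0; 1; 1; 0; 0; 0]`_j.

(** Only the first [i] parameters are free; [family 0] is a single point. *)
Definition family (i : nat) : set (bipspace K 5 5) :=
  [set p | exists u, [/\ forall j, (i <= j)%N -> u j = base j,
    general_eq (param_l u) (param_r u) != 0 & p = param_point u]].

Lemma param_sym u : (param_l u)^T = param_l u /\ (param_r u)^T = param_r u.
Proof. by split; apply: congr_sym; rewrite ?fiber_mx_sym ?trmx1. Qed.

Lemma param_coords u : general_eq (param_l u) (param_r u) != 0 ->
  [/\ coords_of (param_l u) != 0, coords_of (param_r u) != 0,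
      sym_of (coords_of (param_l u)) = param_l u &
      sym_of (coords_of (param_r u)) = param_r u].
Proof.
have [sl sr] := param_sym u.
have det0 (A : 'M[K]_3) : mixdet A A A != 0 -> A != 0.
  by rewrite -det3; apply: contra_neq => ->; rewrite det0.
rewrite /general_eq !mulf_eq0 !negb_or => /andP[/andP[/det0 l0 /det0 r0] _].
by split; [exact: coords_of_neq0|exact: coords_of_neq0|exact: coords_ofK|exact: coords_ofK].
Qed.

Lemma family_zero_locus f u : bihomogeneous f ->
  general_eq (param_l u) (param_r u) != 0 ->
  zero_locus [set f] (param_point u) <->
  meval (join (coords_of (param_l u)) (coords_of (param_r u))) f = 0.
Proof.
move=> fh /param_coords[l0 r0 _ _]; rewrite zero_locus1.
by split=> /eqP e; apply/eqP; move: e; rewrite meval_bipoint.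
Qed.

Lemma family_transverse i p : family i p ->
  transverse p /\ zero_locus [set cayley_eq (genl K) (genr K)] p.
Proof.
move=> [u [_ g0 ->]]; have [l0 r0 lE rE] := param_coords g0.
split; last first.
  apply/(family_zero_locus (bihom_cayley_eq K) g0).
  by rewrite meval_cayley_eq lE rE cayley_eq_param.
rewrite transverse_zero_locus => /(family_zero_locus (bihom_general_eq K) g0)/eqP.
by rewrite meval_general_eq lE rE (negbTE g0).
Qed.

Lemma family_le i : family i `<=` family i.+1.
Proof.
by move=> p [u [ub g0 pE]]; exists u; split=> // j ij; apply: ub; exact: ltnW.
Qed.

Definition bump_base i j := base j + (i == j)%:R.

Lemma general_eq_base : general_eq (param_l base) (param_r base) != 0.
Proof.
rewrite general_eq_param; apply: mulf_neq0.
  by rewrite /base /= mulr1 expr1n oner_eq0.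
rewrite (@fiber_mx_ext _ _ 2 0 0 0) //.
rewrite (_ : general_eq _ _ = 720 ^+ 2); first by rewrite expf_neq0 // pnatr_eq0.
by rewrite /general_eq /pencil_disc /disc /s30 /s21 /s12 /s03 /mixdet !mxE /=; ring.
Qed.

Lemma general_eq_bump i : general_eq (param_l (bump_base i)) (param_r (bump_base i)) != 0.
Proof.
rewrite general_eq_param; apply: mulf_neq0.
  have b4 (k : bool) : 1 + k%:R != 0 :> K by rewrite nat1r pnatr_eq0.
  by rewrite expf_neq0 // /bump_base /base /= mulf_neq0.
case: i => [|[|[|[|i]]]].
- rewrite (@fiber_mx_ext _ _ 3 0 0 0) /bump_base /base /= ?addr0 //; last by ring.
  rewrite (_ : general_eq _ _ = 10080 ^+ 2).
    by rewrite !(mulf_neq0, expf_neq0) // pnatr_eq0.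
  by rewrite /general_eq /pencil_disc /disc /s30 /s21 /s12 /s03 /mixdet !mxE /=; ring.
- rewrite (@fiber_mx_ext _ _ 2 1 0 0) /bump_base /base /= ?(addr0, add0r) //.
  rewrite (_ : general_eq _ _ = (9 * 9 * 25 * 49 * 17)).
    by rewrite !(mulf_neq0, expf_neq0) // pnatr_eq0.
  by rewrite /general_eq /pencil_disc /disc /s30 /s21 /s12 /s03 /mixdet !mxE /=; ring.
- rewrite (@fiber_mx_ext _ _ 2 0 1 0) /bump_base /base /= ?(addr0, add0r) //.
  rewrite (_ : general_eq _ _ = (25 * 49 * 49 * 29)).
    by rewrite !(mulf_neq0, expf_neq0) // pnatr_eq0.
  by rewrite /general_eq /pencil_disc /disc /s30 /s21 /s12 /s03 /mixdet !mxE /=; ring.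
- rewrite (@fiber_mx_ext _ _ 2 0 0 1) /bump_base /base /= ?(addr0, add0r) //.
  rewrite (_ : general_eq _ _ = (512 * 25 * 121)).
    by rewrite !(mulf_neq0, expf_neq0) // pnatr_eq0.
  by rewrite /general_eq /pencil_disc /disc /s30 /s21 /s12 /s03 /mixdet !mxE /=; ring.
- rewrite (@fiber_mx_ext _ _ 2 0 0 0) /bump_base /base /= ?(addr0, add0r) //.
  rewrite (_ : general_eq _ _ = 720 ^+ 2).
    by rewrite !(mulf_neq0, expf_neq0) // pnatr_eq0.
  by rewrite /general_eq /pencil_disc /disc /s30 /s21 /s12 /s03 /mixdet !mxE /=; ring.
Qed.

Lemma family_bump i : family i.+1 (param_point (bump_base i)).
Proof.
exists (bump_base i); split=> //; last exact: general_eq_bump.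
by move=> j ij; rewrite /bump_base (ltn_eqF ij) addr0.
Qed.

Lemma family_irreducible i : irreducible (family i).
Proof.
apply: curve_irreducible.
  by exists (param_point base), base; split=> //; exact: general_eq_base.
move=> _ _ [u [ub gu ->]] [v [vb gv ->]].
pose U j : {poly K} := (u j)%:P + (v j - u j)%:P * 'X.
pose w t j : K := u j + (v j - u j) * t.
have hU t : horner_eval t \o U = w t.
  by apply/funext => j; rewrite /= /horner_eval /U !hornerE.
have w0 : w 0 = u by apply/funext => j; rewrite /w mulr0 addr0.
have w1 : w 1 = v by apply/funext => j; rewrite /w mulr1 addrC subrK.
pose h := general_eq (param_l U) (param_r U).
have hE t : root h t = (general_eq (param_l (w t)) (param_r (w t)) == 0).
  have [el er] := map_param (horner_eval t) U.
  by rewrite /root -/(horner_eval t h) -map_general_eq el er hU.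
have cE t : map_mx (horner_eval t) (coords_of (param_l U)) = coords_of (param_l (w t)) /\
    map_mx (horner_eval t) (coords_of (param_r U)) = coords_of (param_r (w t)).
  have [el er] := map_param (horner_eval t) U.
  by rewrite !map_coords_of el er hU.
have pE t : curve_point (coords_of (param_l U)) (coords_of (param_r U)) t =
    param_point (w t).
  by rewrite /curve_point; have [-> ->] := cE t.
exists (coords_of (param_l U)), (coords_of (param_r U)), h; split.
- by rewrite pE w0.
- by rewrite pE w1.
- by rewrite hE w0.
- by rewrite hE w1.
move=> t; rewrite hE => gt; have [-> ->] := cE t.
have [l0 r0 _ _] := param_coords gt; split=> //.
exists (w t); split=> // j ij.
by rewrite /w ub // vb // subrr mul0r addr0.
Qed.

(** The [i]-th entry holds on [family i] but fails once parameter [i] is raised by one from its base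
    value. The first compares entries [4] and [1] of the base conic; the others say that an entry is
    zero or that two diagonal entries of [D] agree. *)
Definition separator (i : nat) : mpoly (6 + 6) K :=
  let l k := varl K 5 (inord k) in let r k := varr K 5 (inord k) in
  nth 0 [:: l 5 - l 3 *+ 4; l 1; l 2; l 4; r 0 - r 3; r 0 - r 5; r 4; r 1; r 2] i.

Lemma separator_bihomogeneous i : bihomogeneous (separator i).
Proof.
have l k := @bihom_varl K 5 5 (inord k); have r k := @bihom_varr K 5 5 (inord k).
have z : bihomogeneous (0 : mpoly (6 + 6) K) by exists 0%N, 0%N; exact: bihom0.
rewrite /separator.
case: i => [|[|[|[|[|[|[|[|[|i]]]]]]]]] /=; rewrite ?nth_nil //;
  do ?[exact: (bihom_bihomogeneous (l _)) | exact: (bihom_bihomogeneous (r _))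
     | exact: (bihom_bihomogeneous (bihomB (r _) (r _)))].
exact: (bihom_bihomogeneous (bihomB (l _) (bihomMn 4 (l _)))).
Qed.

Lemma coords_ofE (A : 'M[K]_3) : [/\ coords_of A 0 (inord 0) = A o0 o0,
  coords_of A 0 (inord 1) = A o0 o1, coords_of A 0 (inord 2) = A o0 o2 &
  [/\ coords_of A 0 (inord 3) = A o1 o1, coords_of A 0 (inord 4) = A o1 o2 &
  coords_of A 0 (inord 5) = A o2 o2]].
Proof.
by do ![split]; rewrite mxE !inordK //=; congr (A _ _); apply: val_inj; rewrite /= inordK.
Qed.

Lemma meval_separator i u :
  meval (join (coords_of (param_l u)) (coords_of (param_r u))) (separator i) =
  let C := param_l u in let D := param_r u in
  [:: C o2 o2 - C o1 o1 *+ 4; C o0 o1; C o0 o2; C o1 o2; D o0 o0 - D o1 o1;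
      D o0 o0 - D o2 o2; D o1 o2; D o0 o1; D o0 o2]`_i.
Proof.
have [l0 l1 l2 [l3 l4 l5]] := coords_ofE (param_l u).
have [r0 r1 r2 [r3 r4 r5]] := coords_ofE (param_r u).
rewrite /separator.
case: i => [|[|[|[|[|[|[|[|[|i]]]]]]]]] /=;
  rewrite ?nth_nil ?meval0 ?mevalB ?mevalMn ?meval_varl ?meval_varr //;
  by rewrite ?l0 ?l1 ?l2 ?l3 ?l4 ?l5 ?r0 ?r1 ?r2 ?r3 ?r4 ?r5.
Qed.

Lemma separator_family i : (i < 9)%N -> vanishes (separator i) (family i).
Proof.
move=> i9 p [u [ub g0 ->]]; apply/(family_zero_locus (separator_bihomogeneous i) g0).
rewrite meval_separator.
case: i i9 ub => [|[|[|[|[|[|[|[|[|//]]]]]]]]] _ ub;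
  rewrite /= !mxE !sum3 !mxE !sum3 !mxE /=.
- rewrite ?(ub 0%N isT) ?(ub 1%N isT) ?(ub 2%N isT) ?(ub 3%N isT) ?(ub 4%N isT) ?(ub 5%N isT) ?(ub 6%N isT) ?(ub 7%N isT) ?(ub 8%N isT); rewrite /base /=; ring.
- rewrite ?(ub 1%N isT) ?(ub 2%N isT) ?(ub 3%N isT) ?(ub 4%N isT) ?(ub 5%N isT) ?(ub 6%N isT) ?(ub 7%N isT) ?(ub 8%N isT); rewrite /base /=; ring.
- rewrite ?(ub 2%N isT) ?(ub 3%N isT) ?(ub 4%N isT) ?(ub 5%N isT) ?(ub 6%N isT) ?(ub 7%N isT) ?(ub 8%N isT); rewrite /base /=; ring.
- rewrite ?(ub 3%N isT) ?(ub 4%N isT) ?(ub 5%N isT) ?(ub 6%N isT) ?(ub 7%N isT) ?(ub 8%N isT); rewrite /base /=; ring.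
- rewrite ?(ub 4%N isT) ?(ub 5%N isT) ?(ub 6%N isT) ?(ub 7%N isT) ?(ub 8%N isT); rewrite /base /=; ring.
- rewrite ?(ub 5%N isT) ?(ub 6%N isT) ?(ub 7%N isT) ?(ub 8%N isT); rewrite /base /=; ring.
- rewrite ?(ub 6%N isT) ?(ub 7%N isT) ?(ub 8%N isT); rewrite /base /=; ring.
- rewrite ?(ub 7%N isT) ?(ub 8%N isT); rewrite /base /=; ring.
- rewrite ?(ub 8%N isT); rewrite /base /=; ring.
Qed.

Lemma separator_bump i : (i < 9)%N ->
  ~ zero_locus [set separator i] (param_point (bump_base i)).
Proof.
move=> i9 /(family_zero_locus (separator_bihomogeneous i) (general_eq_bump i)).
rewrite meval_separator; apply/eqP.
have nz (N : nat) (x : K) : x = N.+1%:R -> x != 0 by move=> ->; rewrite pnatr_eq0.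
have nz' (N : nat) (x : K) : x = - N.+1%:R -> x != 0.
  by move=> ->; rewrite oppr_eq0 pnatr_eq0.
case: i i9 => [|[|[|[|[|[|[|[|[|//]]]]]]]]] _ /=;
  rewrite !mxE !sum3 !mxE !sum3 !mxE /= /bump_base /base /=.
- by apply: (nz 4%N); ring.
- by apply: (nz 0%N); ring.
- by apply: (nz 0%N); ring.
- by apply: (nz 0%N); ring.
- by apply: (nz' 2%N); ring.
- by apply: (nz' 2%N); ring.
- by apply: (nz 0%N); ring.
- by apply: (nz 0%N); ring.
- by apply: (nz 0%N); ring.
Qed.

End Family.
End Parametrization.

(** * The dimension of the Cayley set *)

Section CayleyDimension.
Variable K : numClosedFieldType.
Hypothesis arch : forall e : K, 0 < e -> exists n, 2^-1 ^+ n < e.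

(** The chain consists of the traces of the closures of [family 0], ..., [family 9]. It is strict
    because the point of [bump_base i] is in [family i.+1] while [separator i] excludes it from the
    closure of [family i]. *)
Lemma cayley_chain : exists Z, irreducible_chain (cayley_set (K := K)) 9 Z.
Proof.
exists (fun i => cayley_set `&` closure (@family K i)).
have fam i : @family K i `<=` cayley_set `&` closure (@family K i).
  move=> p pf; split; last exact: subset_closure.
  by rewrite cayley_zero_locus //; exact: family_transverse pf.
split=> i i9.
  split; first by exists (closure (@family K i)) => //; exact: closed_closure.
  by apply: irreducible_closure (@family_irreducible K i) (fam i) _ => p [].
rewrite properEneq; split.
  apply/eqP => e; have [_] : (cayley_set `&` closure (@family K i))
    (param_point (@bump_base K i)) by rewrite e; apply: fam; exact: family_bump.
  have /closure_id cl := closed_zero_locus1 (@separator_bihomogeneous K i).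
  move=> /(closure_subset (separator_family i9)); rewrite -cl.
  exact: separator_bump.
by apply: setIS; apply: closure_subset; exact: family_le.
Qed.

Lemma cayley_eq_neq0 : cayley_eq (genl K) (genr K) != 0.
Proof.
apply/eqP => /(congr1 (meval (join (coords_of 1%:M) (coords_of 1%:M)))).
rewrite meval_cayley_eq meval0 !coords_ofK ?trmx1 //.
(* For [C = D = 1] the cubic is [(t + 1)^3], and the equation takes the value [-9 + 12]. *)
rewrite (_ : cayley_eq _ _ = 3); first by move/eqP; rewrite pnatr_eq0.
by rewrite /cayley_eq /s12 /s03 /s21 /mixdet !mxE /=; ring.
Qed.

Lemma cayley_dimension : has_dimension (cayley_set (K := K)) 9.
Proof.
split=> [|e Z chainZ]; first exact: cayley_chain.
have := hypersurface_chain cayley_eq_neq0 (bihom_cayley_eq K) _ chainZ.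
by rewrite ltnS; apply; rewrite cayley_zero_locus // => p [].
Qed.

End CayleyDimension.

Theorem proposition1 (R : realType) :
  [/\ constructible (cayley_set (K := R[i])),
      closed_in (transverse (K := R[i])) cayley_set,
      cayley_set (K := R[i]) = transverse `&`
        [set p : bipspace R[i] 5 5 |
          let C := conic_mx p.1 in let D := conic_mx p.2 in
          - sigma12 C D ^+ 2 + 4 * sigma03 C D * sigma21 C D = 0]
    & has_dimension (cayley_set (K := R[i])) 9].
Proof.
have arch := @complex_archimedean R.
have closedC := closed_zero_locus1 (bihom_cayley_eq R[i]).
have cayleyZ := cayley_zero_locus arch.
split; last exact: cayley_dimension.
(* A single locally closed piece suffices. *)
- exists 1%N, (fun _ => cayley_set); split.
    move=> _; exists transverse, (zero_locus [set cayley_eq (genl R[i]) (genr R[i])]).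
    by split=> //; exact: open_transverse.
  by rewrite bigcup_const //; exists ord0.
- by exists (zero_locus [set cayley_eq (genl R[i]) (genr R[i])]).
- exact: cayley_eqE.
Qed.
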